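(* Let $q>1$. There exists $c_q>0$, depending only on $q$, such that for every weighted graph $(V,E,\mu)$ with vertex weight $\sigma$ and $\nu$-adapted edge-length function $\rho$ whose path metric $d_\rho$ is proper (as in the context), and for every $o\in V$, $$\mathcal H_{q,\sigma}(o):=\int_0^\infty\sum_{x\in V}p_\sigma(t,o,x)^q\,\nu(x)\,dt\ \ge\ c_q\int_2^\infty\frac{r}{M_o(r)^{q-1}}\,dr,$$ both sides taking values in $[0,\infty]$.
   Context: Let $(V,E)$ be an infinite, connected, locally finite graph with at most one edge between two distinct vertices and no loops. Let $\mu:V\times V\to[0,\infty)$ be symmetric with $\mu_{xy}>0$ if $x\sim y$ and $\mu_{xy}=0$ otherwise; put $\mu(x)=\sum_{y\sim x}\mu_{xy}$. Fix $\sigma:V\to(0,\infty)$ and set $\nu(x)=\sigma(x)\mu(x)$, $\nu(A)=\sum_{x\in A}\nu(x)$. The operator is $$\Delta_\sigma f(x)=\frac1{\nu(x)}\sum_{y\sim x}\mu_{xy}(f(y)-f(x)).$$ A positive symmetric edge-length function $\rho:E\to(0,\infty)$ is $\nu$-adapted if $\sum_{y\sim x}\mu_{xy}\rho(x,y)^2\le\nu(x)$ for all $x\in V$. Its path metric is $d_\rho(x,y)=\inf\sum_{i=1}^n\rho(x_{i-1},x_i)$, the infimum over paths $x=x_0\sim x_1\sim\dots\sim x_n=y$. Properness of $d_\rho$ means that every ball $B_\rho(o,r)=\{x\in V:d_\rho(o,x)\le r\}$ is finite. Put $M_o(r)=\nu(B_\rho(o,r))$. For finite connected $D\subset V$, the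 Dirichlet operator $\Delta_{\sigma,D}$ is obtained by extending functions on $D$ by zero outside $D$ and applying $\Delta_\sigma$ on $D$; $p_{\sigma,D}(t,x,y)$ is its heat kernel with respect to $\nu$, i.e. $e^{t\Delta_{\sigma,D}}f(x)=\sum_{y\in D}p_{\sigma,D}(t,x,y)f(y)\nu(y)$. The minimal heat kernel $p_\sigma(t,x,y)$ is the monotone limit of $p_{\sigma,D_j}(t,x,y)$ along exhaustions of $V$ by finite connected sets $D_j$. *)

(* Defs.v *)
From HB Require Import structures.
From mathcomp Require Import all_boot all_order all_algebra.
From mathcomp Require Import all_classical all_reals all_analysis.
From mathcomp Require Import finmap.

Set Implicit Arguments.
Unset Strict Implicit.
Unset Printing Implicit Defensive.

Import Order.TTheory GRing.Theory Num.Theory.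
Import numFieldNormedType.Exports.

Local Open Scope classical_set_scope.
Local Open Scope ring_scope.

Section Paths.
Context {V : choiceType}.

Definition joined_in (e : rel V) (D : set V) (x y : V) : Prop :=
  exists p : seq V,
    [/\ path e x p, last x p = y & forall z, z \in x :: p -> D z].

Definition connected_in (e : rel V) (D : set V) : Prop :=
  forall x y, D x -> D y -> joined_in e D x y.

End Paths.

Record wgraph (R : realType) (V : choiceType) := WGraph {
  adj : rel V;
  edge_weight : V -> V -> R;
  vertex_weight : V -> R;
  vertices_infinite : infinite_set [set: V];
  adj_sym : symmetric adj;
  adj_irr : irreflexive adj;
  adj_connected : connected_in adj [set: V];
  adj_locally_finite : forall x, finite_set [set y | adj x y];
  edge_weight_sym : forall x y, edge_weight x y = edge_weight y x;
  edge_weight_gt0 : forall x y, adj x y -> 0 < edge_weight x y;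
  edge_weight_eq0 : forall x y, ~~ adj x y -> edge_weight x y = 0;
  vertex_weight_gt0 : forall x, 0 < vertex_weight x
}.

Section WeightedGraph.
Context {R : realType} {V : choiceType} (G : wgraph R V).

Definition nbr (x : V) : set V := [set y | adj G x y].

Definition mu (x : V) : R := \sum_(y \in nbr x) edge_weight G x y.

Definition nu (x : V) : R := vertex_weight G x * mu x.

Definition laplacian (f : V -> R) (x : V) : R :=
  (nu x)^-1 * \sum_(y \in nbr x) edge_weight G x y * (f y - f x).

(* An edge length is a function on pairs of vertices; its values at
   nonadjacent pairs are unconstrained and never used. *)
Definition edge_length (rho : V -> V -> R) : Prop :=
  (forall x y, adj G x y -> 0 < rho x y) /\
  (forall x y, adj G x y -> rho x y = rho y x).

Definition adapted (rho : V -> V -> R) : Prop :=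
  forall x, \sum_(y \in nbr x) edge_weight G x y * rho x y ^+ 2 <= nu x.

(* The pairs in zip (x :: p) p are the consecutive vertices of x :: p. *)
Definition path_length (rho : V -> V -> R) (x : V) (p : seq V) : R :=
  \sum_(e <- zip (x :: p) p) rho e.1 e.2.

Definition path_dist (rho : V -> V -> R) (x y : V) : R :=
  inf [set path_length rho x p | p in
         [set p : seq V | path (adj G) x p /\ last x p = y]].

Definition dball (rho : V -> V -> R) (o : V) (r : R) : set V :=
  [set x | path_dist rho o x <= r].

Definition proper_dist (rho : V -> V -> R) : Prop :=
  forall o r, finite_set (dball rho o r).

(* Finitely supported sum: meaningful since the balls are finite. *)
Definition ball_volume (rho : V -> V -> R) (o : V) (r : R) : R :=
  \sum_(x \in dball rho o r) nu x.

(* Functions on D are represented by their extensions by zero to V. *)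
Definition ext0 (D : set V) (f : V -> R) : V -> R := patch (fun=> 0) D f.

Definition dirichlet_laplacian (D : set V) (f : V -> R) : V -> R :=
  ext0 D (laplacian (ext0 D f)).

Definition dirichlet_semigroup (D : set V) (t : R) (f : V -> R) (x : V) : R :=
  limn (series (fun k => exp_coeff t k *
                         iter k (dirichlet_laplacian D) (ext0 D f) x)).

(* The kernel of the semigroup with respect to nu, read off from its action
   on the indicator of y; it vanishes unless x and y both belong to D.  The
   defining identity is dirichlet_semigroupE below. *)
Definition dirichlet_heat_kernel (D : set V) (t : R) (x y : V) : R :=
  dirichlet_semigroup D t \1_[set y] x / nu y.

Definition exhaustion (D : nat -> set V) : Prop :=
  [/\ forall j, finite_set (D j) /\ connected_in (adj G) (D j),
      forall j, D j `<=` D j.+1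
    & \bigcup_j D j = [set: V]].

(* The Dirichlet kernels increase along the exhaustion D, and the limit does
   not depend on it; exhaustions exist by exhaustion_exists below. *)
Definition heat_kernel (D : nat -> set V) (t : R) (x y : V) : R :=
  limn (fun j => dirichlet_heat_kernel (D j) t x y).

Definition Hq (D : nat -> set V) (q : R) (o : V) : \bar R :=
  (\int[lebesgue_measure]_(t in `[0%R, +oo[)
     \esum_(x in [set: V]) (heat_kernel D t o x `^ q * nu x)%:E)%E.

End WeightedGraph.

Section Facts.
Context {R : realType} {V : choiceType} (G : wgraph R V).

Lemma mu_gt0 (x : V) : 0 < mu G x.
Proof.
have [z xz] : exists z, z != x.
  apply: contrapT => hx; apply: (vertices_infinite G).
  apply: (@sub_finite_set _ _ [set x]); last exact: finite_set1.
  move=> z _ /=; apply: contrapT => /eqP zx; apply: hx; by exists z.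
have [p [+ + _]] := @adj_connected _ _ G x z I I.
case: p => [_ /= zx|y p /= /andP[xy _] _]; first by rewrite zx eqxx in xz.
rewrite /mu (fsbigD1 y) //=; last exact: adj_locally_finite.
apply: ltr_wpDr; last exact: edge_weight_gt0.
by apply: fsumr_ge0 => w [/= xw _]; exact/ltW/edge_weight_gt0.
Qed.

Lemma nu_gt0 (x : V) : 0 < nu G x.
Proof. by apply: mulr_gt0; [exact: vertex_weight_gt0 | exact: mu_gt0]. Qed.

Lemma edge_weight_ge0 (x y : V) : 0 <= edge_weight G x y.
Proof.
case: (boolP (adj G x y)) => [/edge_weight_gt0/ltW //|/edge_weight_eq0 -> //].
Qed.

Lemma ext0E (D : set V) (f : V -> R) x :
  (ext0 D f) x = if x \in D then f x else 0.
Proof. by []. Qed.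

Lemma laplacianE (f : V -> R) x :
  laplacian G f x = (nu G x)^-1 * \sum_(y <- fset_set (nbr G x))
                      edge_weight G x y * (f y - f x).
Proof.
by rewrite /laplacian fsbig_finite //; exact: adj_locally_finite.
Qed.

Lemma dirichlet_laplacian_sum (D : set V) (s : seq V) (a : V -> R)
    (g : V -> V -> R) :
  dirichlet_laplacian G D (fun x => \sum_(z <- s) a z * g z x) =
  fun x => \sum_(z <- s) a z * dirichlet_laplacian G D (g z) x.
Proof.
apply/funext => x; rewrite /dirichlet_laplacian ext0E.
case: ifPn => xD; last first.
  by rewrite big1 // => z _; rewrite ext0E (negbTE xD) mulr0.
under [RHS]eq_bigr do rewrite ext0E xD laplacianE.
rewrite laplacianE.
have h y : ext0 D (fun x => \sum_(z <- s) a z * g z x) y =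
           \sum_(z <- s) a z * (ext0 D (g z)) y.
  rewrite ext0E; case: ifPn => yD.
    by apply: eq_bigr => z _; rewrite ext0E yD.
  by rewrite big1 // => z _; rewrite ext0E (negbTE yD) mulr0.
rewrite [in LHS](eq_bigr (fun y => \sum_(z <- s) edge_weight G x y *
    (a z * (ext0 D (g z)) y - a z * (ext0 D (g z)) x))); last first.
  by move=> y _; rewrite !h -sumrB mulr_sumr.
rewrite exchange_big /= mulr_sumr; apply: eq_bigr => z _.
rewrite mulrCA; congr (_ * _); rewrite mulr_sumr; apply: eq_bigr => y _.
by rewrite -mulrBr mulrCA.
Qed.

Lemma iter_dirichlet_laplacian_sum (D : set V) (s : seq V) (a : V -> R)
    (g : V -> V -> R) k :
  iter k (dirichlet_laplacian G D) (fun x => \sum_(z <- s) a z * g z x) =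
  fun x => \sum_(z <- s) a z * iter k (dirichlet_laplacian G D) (g z) x.
Proof. by elim: k => //= k ->; rewrite dirichlet_laplacian_sum. Qed.

Lemma dirichlet_laplacian_bounded (D : set V) : finite_set D ->
  exists2 C : R, 0 <= C & forall (f : V -> R) (K : R),
    (forall x, `|f x| <= K) ->
    forall x, `|dirichlet_laplacian G D f x| <= C * K.
Proof.
move=> Dfin.
pose c x := (nu G x)^-1 *
  \sum_(y <- fset_set (nbr G x)) edge_weight G x y * 2.
have c0 x : 0 <= c x.
  apply: mulr_ge0; first by rewrite invr_ge0 ltW ?nu_gt0.
  by apply: sumr_ge0 => y _; rewrite mulr_ge0 ?edge_weight_ge0.
exists (\sum_(x <- fset_set D) c x); first by apply: sumr_ge0.
move=> f K fK x.
have K0 : 0 <= K by apply: le_trans (fK x).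
rewrite /dirichlet_laplacian ext0E; case: ifPn => xD; last first.
  by rewrite normr0 mulr_ge0 // sumr_ge0.
have xs : x \in fset_set D by rewrite in_fset_set.
apply: (@le_trans _ _ (c x * K)); last first.
  apply: ler_wpM2r => //; rewrite (big_fsetD1 x) //= lerDl.
  exact: sumr_ge0.
rewrite laplacianE normrM /c -mulrA ger0_norm ?invr_ge0 ?(ltW (nu_gt0 _)) //.
apply: ler_wpM2l; first by rewrite invr_ge0 ltW ?nu_gt0.
apply: le_trans (ler_norm_sum _ _ _) _; rewrite mulr_suml.
apply: ler_sum => y _.
rewrite normrM ger0_norm ?edge_weight_ge0 // -mulrA.
apply: ler_wpM2l; first exact: edge_weight_ge0.
have fDK z : `|(ext0 D f) z| <= K.
  by rewrite ext0E; case: ifP => _; rewrite ?normr0.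
by apply: le_trans (ler_normB _ _) _; rewrite mulr2n mulrDl mul1r lerD.
Qed.

Lemma is_cvg_dirichlet_semigroup (D : set V) (t : R) (f : V -> R) (x : V) :
  finite_set D ->
  cvgn (series (fun k => exp_coeff t k *
                  iter k (dirichlet_laplacian G D) (ext0 D f) x)).
Proof.
move=> Dfin; have [C C0 CP] := dirichlet_laplacian_bounded Dfin.
pose K := \sum_(x <- fset_set D) `|f x|.
have K0 : 0 <= K by apply: sumr_ge0.
have fK z : `|(ext0 D f) z| <= K.
  rewrite ext0E; case: ifPn => zD; last by rewrite normr0.
  have zs : z \in fset_set D by rewrite in_fset_set.
  by rewrite /K (big_fsetD1 z) //= lerDl sumr_ge0.
have iK k : forall z,
    `|iter k (dirichlet_laplacian G D) (ext0 D f) z| <= C ^+ k * K.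
  elim: k => [z|k IH z] /=; first by rewrite expr0 mul1r.
  by rewrite exprS -mulrA; exact: CP.
apply: normed_cvg.
apply: (@series_le_cvg _ _ (K *: exp_coeff (`|t| * C))).
- by move=> n; exact: normr_ge0.
- move=> n; apply: mulr_ge0 => //.
  by rewrite /exp_coeff /= divr_ge0 ?exprn_ge0 // mulr_ge0.
- move=> n; rewrite /exp_coeff /= !normrM normrX.
  have nf : `|n`!%:R^-1 : R| = n`!%:R^-1 by rewrite ger0_norm.
  rewrite nf.
  rewrite [leRHS](_ : _ = `|t| ^+ n / n`!%:R * (C ^+ n * K)).
    by apply: ler_wpM2l => //; rewrite divr_ge0 ?exprn_ge0.
  rewrite [LHS](_ : _ = K * ((`|t| * C) ^+ n / n`!%:R)) // exprMn.
  by rewrite mulrC -!mulrA; congr (_ * _); rewrite mulrCA.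
- by apply: is_cvg_seriesZ; exact: is_cvg_series_exp_coeff.
Qed.

Lemma dirichlet_semigroupE (D : set V) (t : R) (f : V -> R) (x : V) :
  finite_set D ->
  dirichlet_semigroup G D t f x =
  \sum_(y \in D) dirichlet_heat_kernel G D t x y * f y * nu G y.
Proof.
move=> Dfin; rewrite fsbig_finite //=.
have -> : \sum_(y <- fset_set D)
      dirichlet_heat_kernel G D t x y * f y * nu G y =
    \sum_(y <- fset_set D) f y * dirichlet_semigroup G D t \1_[set y] x.
  apply: eq_bigr => y _; rewrite /dirichlet_heat_kernel mulrAC.
  by rewrite divfK ?gt_eqF ?nu_gt0 // mulrC.
have fE : ext0 D f = fun z => \sum_(y <- fset_set D) f y * (ext0 D \1_[set y]) z.
  apply/funext => z; rewrite ext0E; case: ifPn => zD; last first.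
    by rewrite big1 // => y _; rewrite ext0E (negbTE zD) mulr0.
  have zs : z \in fset_set D by rewrite in_fset_set.
  rewrite (big_fsetD1 z) //= ext0E zD indicE mem_set // mulr1.
  rewrite big_seq big1 ?addr0 // => y; rewrite !inE => /andP[yz _].
  rewrite ext0E zD indicE memNset ?mulr0 //=.
  by move=> /eqP; rewrite eq_sym; exact/negP.
apply/cvg_lim => //; rewrite fE.
have seriesE : series (fun k => exp_coeff t k *
      iter k (dirichlet_laplacian G D)
        (fun z => \sum_(y <- fset_set D) f y * (ext0 D \1_[set y]) z) x) =
    fun n => \sum_(y <- fset_set D) f y * series (fun k => exp_coeff t k *
      iter k (dirichlet_laplacian G D) (ext0 D \1_[set y]) x) n.
  apply/funext => n; rewrite /series /=.
  under eq_bigr do rewrite iter_dirichlet_laplacian_sum mulr_sumr.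
  rewrite exchange_big /=; apply: eq_bigr => y _; rewrite mulr_sumr.
  by apply: eq_bigr => k _; rewrite mulrCA.
rewrite seriesE; elim: (enum_fset _) => [|y s IH].
  rewrite big_nil; under eq_fun do rewrite big_nil; exact: cvg_cst.
rewrite big_cons; under eq_fun do rewrite big_cons.
apply: cvgD IH; apply: cvgMl_tmp; exact: is_cvg_dirichlet_semigroup.
Qed.

Lemma exhaustion_exists : exists D, exhaustion G D.
Proof.
have [ o _] : [set: V] !=set0.
  by apply/set0P/eqP => V0; apply: (vertices_infinite G); rewrite V0.
pose D := fix D n := if n is m.+1 then
  D m `|` \bigcup_(x in D m) nbr G x else [set o].
have Dsub j : D j `<=` D j.+1 by left.
have joined_o j x : D j x -> joined_in (adj G) (D j) o x.
  elim: j x => [x /= ->|j IH x].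
    by exists [::]; split=> // z; rewrite inE => /eqP.
  have step y : D j y -> joined_in (adj G) (D j.+1) o y.
    by move=> /IH[p [? ? pD]]; exists p; split=> // z /pD /Dsub.
  case=> [/step //|[y Dy yx]].
  have [p [pp py pD]] := step _ Dy; exists (rcons p x).
  rewrite rcons_path last_rcons pp py yx; split=> // z.
  rewrite -rcons_cons mem_rcons inE => /orP[/eqP ->|/pD //].
  by right; exists y.
have join_sym j x y :
    joined_in (adj G) (D j) x y -> joined_in (adj G) (D j) y x.
  case=> p [pp py pD]; exists (rev (belast x p)).
  have eqm : y :: rev (belast x p) = rev (x :: p).
    by rewrite [in RHS]lastI rev_rcons py.
  split.
  - rewrite -py rev_path; apply: sub_path pp => u v.
    by rewrite adj_sym.
  - case: p {pp pD eqm} py => //= z p _; rewrite rev_cons last_rcons //.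
  - by move=> z; rewrite eqm mem_rev; exact: pD.
exists D; split=> //.
- move=> j; split.
    elim: j => [|j IH]; first exact: finite_set1.
    rewrite finite_setU; split=> //; apply: bigcup_finite => // x _.
    exact: adj_locally_finite.
  move=> x y /joined_o/join_sym[p [pp po pD]] /joined_o[r [rp ry rD]].
  exists (p ++ r); split; first by rewrite cat_path pp po.
    by rewrite last_cat po.
  move=> z; rewrite -cat_cons mem_cat => /orP[/pD //|zr].
  by apply: rD; rewrite inE zr orbT.
- rewrite -subTset => x _.
  have [p [pp px _]] := @adj_connected _ _ G o x I I.
  suff: forall j y, D j y -> path (adj G) y p -> last y p = x ->
      (\bigcup_j D j) x by move=> /(_ 0%N o erefl pp px).
  elim: p {pp px} => [|z p IH] j y Dy /=; first by move=> _ <-; exists j.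
  by move=> /andP[yz zp] zx; apply: (IH j.+1 z) => //; right; exists y.
Qed.

End Facts.

(* Main.v *)
Require Import Defs.
From HB Require Import structures.
From mathcomp Require Import all_boot all_order all_algebra.
From mathcomp Require Import all_classical all_reals all_analysis.
From mathcomp Require Import measurable_realfun finmap ring lra.

(** Fix [o] and a scale [r].  Let [u_t] be the heat kernel from [o] of a finite
    connected domain [D] containing the ball [B] of radius [r], let [W] be the
    volume of [B], and put [p = min (q, 2)], [k = (p - 1) / 2].  The theorem follows
    from an inequality at the single scale [r],

      [r^2 W^(1 - q) <= C int_0^(eps r^2) (t / r^2)^k ||u_t||_q^q dt],

    proved in [heat_scale_lower_bound] with constants that depend on [p] and [q]
    only.  The weight [(t / r^2)^k] is the point of it: summed over the radii
    [r = 2^i] with [t <= r^2] it is a geometric series ([dyadic_weight_sum]), so the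
    sum of the left-hand sides, which is comparable to the integral of
    [r / M_o(r)^(q - 1)], is at most a constant times [int ||u_t||_q^q dt].  By
    domain monotonicity the latter is at most the functional of the minimal kernel.

    As long as a fixed part of the mass stays in [B], splitting at height
    [1 / W] gives [||u_t||_q^q >= c W^(1 - q)], and integrating this over
    [[0, eps r^2]] gives the inequality.  But the distance from [o] may have an
    unbounded drift, and the mass may well leave [B] long before time [r^2].  The
    inequality says that a loss of mass has to be paid for by the integral on the
    right.  Three observations make this precise.

    First, mass leaves [B] along edges whose higher value lies inside.  By the
    Cauchy-Schwarz inequality its flux is controlled by [W^(p - 1)] and by the
    energy [sum mu_xy (u_x - u_y)^2 u_x^(p - 2)] over the edges with [u_x > u_y],
    and only edges starting at distance at least [r / 4] have to be charged this way:
    longer jumps, starting near [o], carry at most [16 / r^2] of the mass per unit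
    time, because the edge lengths are adapted ([mass_flux]).

    Secondly, the energy far from [o] is dissipated by the moment
    [Z = sum nu u^p (d / r)^(2 p)], in a Caccioppoli inequality whose error is
    controlled by [Z] itself and by [||u||_p^p] ([moment_dissipation]).  Edges may be
    arbitrarily long and only the second moment of their lengths is bounded; the
    exponent [2 p] is such that Young's inequality still absorbs the long edges.

    Thirdly, [Z] vanishes at time 0, so it may be given the singular weight
    [(t / r^2)^(- k)].  The functional [M - W^(p - 1) (t / r^2)^(- k) Z], where [M] is
    the mass under a cutoff of [B], starts at 1, and the energies cancel in its
    derivative, which is at least
    [- C r^(- 2) (1 + W^(q - 1) (t / r^2)^k ||u_t||_q^q)] ([lyapunov_derivative]).
    So either the integral on the right is large or [M] stays above [1 / 2].

    The restriction [p <= 2] serves the concavity of [s^(p - 1)]; larger [q]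
    are reached from [p] by the same splitting at height [1 / W]. *)

Set Implicit Arguments.
Unset Strict Implicit.
Unset Printing Implicit Defensive.

Import Order.TTheory GRing.Theory Num.Theory.
Import numFieldNormedType.Exports.

Local Open Scope classical_set_scope.
Local Open Scope ring_scope.

(** * Scalar inequalities *)

Section ScalarInequalities.
Context {R : realType}.
Implicit Types a b s x y p q : R.

(** Young's inequality for the product of [s `^ p] and [1], with conjugate
    exponents [1 / p] and [1 / (1 - p)]. *)
Lemma bernoulli_powR_le s p : 0 <= s -> 0 < p <= 1 -> s `^ p <= 1 + p * (s - 1).
Proof.
move=> s0 /andP[p0 p1]; move: p1; rewrite le_eqVlt => /predU1P[->|p1].
  by rewrite powRr1// mul1r addrC subrK.
have := @conjugate_powR R (s `^ p) 1 p^-1 (1 - p)^-1 (powR_ge0 _ _) ler01.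
rewrite !invr_gt0 !invrK subr_gt0 => /(_ p0 p1); rewrite addrC subrK => /(_ erefl).
rewrite -powRrM divff ?gt_eqF// powRr1// powR1 mul1r mulr1 => /le_trans; apply.
by rewrite mulrBr mulr1 mulrC; lra.
Qed.

(** A concave power lies below its tangent at [a].  This is what turns the
    derivative of an [L^p] norm along the heat flow into a quadratic energy
    weighted by the value at the higher end of each edge. *)
Lemma powR_chord_le a b p : 0 <= b -> 0 < a -> 1 < p <= 2 ->
  (p - 1) * a `^ (p - 2) * (a - b) <= a `^ (p - 1) - b `^ (p - 1).
Proof.
move=> b0 a0 /andP[p1 p2].
have := @bernoulli_powR_le (b / a) (p - 1) (divr_ge0 b0 (ltW a0)).
rewrite subr_gt0 p1 lerBlDr -[1 + 1]/(2 : R) p2 => /(_ isT).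
have -> : a `^ (p - 1) = a `^ (p - 2) * a.
  rewrite -{3}(powRr1 (ltW a0)) -powRD ?(gt_eqF a0) ?implybT//.
  by congr (_ `^ _); lra.
have -> : b `^ (p - 1) = (b / a) `^ (p - 1) * (a `^ (p - 2) * a).
  rewrite -{3}(powRr1 (ltW a0)) -powRD ?(gt_eqF a0) ?implybT//.
  rewrite (_ : p - 2 + 1 = p - 1); last by lra.
  by rewrite -powRM ?divr_ge0 ?(ltW a0)// divfK ?gt_eqF.
move=> h; have c0 : 0 < a `^ (p - 2) * a by rewrite mulr_gt0 ?powR_gt0.
rewrite -subr_ge0 [leRHS](_ : _ = (a `^ (p - 2) * a) * (1 + (p - 1) * (b / a - 1) - (b / a) `^ (p - 1))).
  by rewrite mulr_ge0 ?subr_ge0// ltW.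
by field; rewrite gt_eqF.
Qed.

(** Bernoulli with the inverse exponent, read at [(x / y) `^ p]. *)
Lemma powR_slope_le x y p : 0 <= x -> x <= y -> 1 <= p ->
  y `^ p - x `^ p <= p * y `^ (p - 1) * (y - x).
Proof.
move=> x0 xy p1; have p0 : 0 < p by rewrite (lt_le_trans ltr01).
move: (le_trans x0 xy); rewrite le_eqVlt => /predU1P[y0|y0].
  have -> : x = 0 by apply/eqP; rewrite eq_le x0 andbT y0.
  by rewrite -y0 !subrr mulr0.
have := @bernoulli_powR_le ((x / y) `^ p) p^-1 (powR_ge0 _ _).
rewrite invr_gt0 p0 invf_le1// p1 => /(_ isT).
rewrite -powRrM divff ?gt_eqF// powRr1; last by rewrite divr_ge0// ltW.
rewrite -(@ler_pM2l _ p)// => h.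
have yE : y `^ p = y * y `^ (p - 1) by rewrite mulr_powRB1// ltW.
have -> : x `^ p = (x / y) `^ p * y `^ p.
  by rewrite -powRM ?divr_ge0 ?(ltW y0)// divfK ?gt_eqF.
rewrite yE -subr_ge0.
rewrite [leRHS](_ : _ = (y * y `^ (p - 1)) * (p * (1 + p^-1 * ((x / y) `^ p - 1)) - p * (x / y))).
  by rewrite mulr_ge0 ?subr_ge0// mulr_ge0 ?powR_ge0// ltW.
by field; rewrite !gt_eqF.
Qed.

(** Here [a] and [b] are the values of a function at the ends of an edge, [x]
    and [y] the distances of these ends from the base point, and the right-hand
    side is the contribution of the edge to the dissipation of the moment
    [sum nu u^p d^(2p)].  Only edges with [x <= y] are a threat; there
    [y^(2p) - x^(2p)] is [(y^p - x^p)^2 + 2 x^p (y^p - x^p)].  The cross term is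
    absorbed by half of the energy, and both remainders are multiples of
    [(x - y)^2 a (b y^2)^(p - 1)].  The jump [x - y] enters with its second power
    only, which is all that adaptedness controls when edges may be long; the
    exponent [2p] of the weight is the one that makes this remainder balance in
    the next lemma. *)
Lemma edge_energy_lower a b x y p : 0 <= b -> b <= a -> 0 < a -> 0 <= x -> 0 <= y ->
  1 < p <= 2 ->
  (p - 1) / 2 * ((a - b) ^+ 2 * a `^ (p - 2) * (x `^ p) ^+ 2)
    - (p ^+ 2 + 2 * p ^+ 2 / (p - 1)) * ((x - y) ^+ 2 * (a * (b * y ^+ 2) `^ (p - 1)))
  <= (a - b) * (a `^ (p - 1) * (x `^ p) ^+ 2 - b `^ (p - 1) * (y `^ p) ^+ 2).
Proof.
move=> b0 ba a0 x0 y0 p12; have /andP[p1 p2] := p12.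
have := @powR_chord_le a b p b0 a0 p12.
have -> : a `^ (p - 1) = a `^ (p - 2) * a.
  rewrite -{3}(powRr1 (ltW a0)) -powRD ?(gt_eqF a0) ?implybT//.
  by congr (_ `^ _); lra.
have -> : (b * y ^+ 2) `^ (p - 1) = b `^ (p - 1) * (y `^ (p - 1)) ^+ 2.
  by rewrite powRM ?exprn_ge0// expr2 powRM// -expr2.
have ab1 : b `^ (p - 1) <= a `^ (p - 2) * a.
  rewrite [leRHS](_ : _ = a `^ (p - 1)); last first.
    rewrite -{2}(powRr1 (ltW a0)) -powRD ?(gt_eqF a0) ?implybT//.
    by congr (_ `^ _); lra.
  by apply: ge0_ler_powR; rewrite ?nnegrE ?subr_ge0 ?(ltW p1)// ltW.
have c0 : 0 < a `^ (p - 2) by rewrite powR_gt0.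
have B0 : 0 <= b `^ (p - 1) by rewrite powR_ge0.
have H0 : 0 <= y `^ (p - 1) by rewrite powR_ge0.
have X0 : 0 <= x `^ p by rewrite powR_ge0.
have Y0 : 0 <= y `^ p by rewrite powR_ge0.
have slope : x <= y -> y `^ p - x `^ p <= p * y `^ (p - 1) * (y - x).
  by move=> xy; apply: powR_slope_le => //; exact: ltW.
have mono : y <= x -> y `^ p <= x `^ p.
  by move=> yx; apply: ge0_ler_powR; rewrite ?nnegrE//; lra.
have mono' : x <= y -> x `^ p <= y `^ p.
  by move=> yx; apply: ge0_ler_powR; rewrite ?nnegrE//; lra.
move: (a `^ (p - 2)) (b `^ (p - 1)) (y `^ (p - 1)) (x `^ p) (y `^ p)
  c0 B0 H0 X0 Y0 slope mono mono' ab1 => c B H X Y c0 B0 H0 X0 Y0 slope mono mono' ab1 chord.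
have d0 : 0 < p - 1 by lra.
have D0 : 0 <= a - b by lra.
have E0 : 0 <= (a - b) ^+ 2 * c * X ^+ 2 by rewrite !mulr_ge0 ?sqr_ge0// ltW.
have main : (p - 1) * ((a - b) ^+ 2 * c * X ^+ 2) <= (a - b) * ((c * a - B) * X ^+ 2).
  rewrite [leLHS](_ : _ = (a - b) * (((p - 1) * c * (a - b)) * X ^+ 2)); last by ring.
  by rewrite ler_wpM2l// ler_wpM2r// sqr_ge0.
have T0 : 0 <= (x - y) ^+ 2 * (a * (B * H ^+ 2)).
  by apply: mulr_ge0 (sqr_ge0 _) (mulr_ge0 (ltW a0) (mulr_ge0 B0 (sqr_ge0 _))).
have [xy|/ltW yx] := leP x y; last first.
  have sq : Y ^+ 2 <= X ^+ 2 by rewrite lerXn2r// ?nnegrE// mono.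
  have K0 : 0 <= p ^+ 2 + 2 * p ^+ 2 / (p - 1).
    by rewrite addr_ge0 ?sqr_ge0// divr_ge0 ?(ltW d0)// mulr_ge0 ?sqr_ge0.
  have h1 : 0 <= (a - b) * (B * (X ^+ 2 - Y ^+ 2)) by rewrite !mulr_ge0// subr_ge0.
  have h2 := mulr_ge0 K0 T0; have h3 := mulr_ge0 (ltW d0) E0.
  move: (_ + _ / _) (_ * (a * _)) h2 => K T h2; lra.
have {}slope := slope xy; have {}mono' := mono' xy.
pose d := y - x; have d0' : 0 <= d by rewrite subr_ge0.
have p0 : 0 < p by lra.
have PHd : 0 <= p * H * d by rewrite !mulr_ge0// ltW.
have sqdiff : Y ^+ 2 - X ^+ 2 <= (p * H * d) ^+ 2 + 2 * X * (p * H * d).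
  (* Y and X stand for y^p and x^p, H for y^(p-1), d for the jump *)
  have e1 : (Y - X) ^+ 2 <= (p * H * d) ^+ 2 by rewrite lerXn2r// ?nnegrE ?subr_ge0.
  have e2 : 2 * X * (Y - X) <= 2 * X * (p * H * d) by rewrite ler_wpM2l// mulr_ge0.
  lra.
have first : (a - b) * (B * (p * H * d) ^+ 2) <= p ^+ 2 * ((x - y) ^+ 2 * (a * (B * H ^+ 2))).
  rewrite [leRHS](_ : _ = a * (B * (p * H * d) ^+ 2)); last by rewrite /d; ring.
  by rewrite ler_wpM2r ?mulr_ge0 ?sqr_ge0//; lra.
have second : (a - b) * (B * (2 * X * (p * H * d))) <=
    (p - 1) / 2 * ((a - b) ^+ 2 * c * X ^+ 2)
    + 2 * p ^+ 2 / (p - 1) * ((x - y) ^+ 2 * (a * (B * H ^+ 2))).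
  have step : 2 * p ^+ 2 / (p - 1) * ((x - y) ^+ 2 * ((B ^+ 2 / c) * H ^+ 2)) <=
     2 * p ^+ 2 / (p - 1) * ((x - y) ^+ 2 * (a * (B * H ^+ 2))).
    apply: ler_wpM2l.
      by rewrite divr_ge0 ?(ltW d0)// mulr_ge0 ?sqr_ge0.
    apply: ler_wpM2l; rewrite ?sqr_ge0// mulrA.
    apply: ler_wpM2r; rewrite ?sqr_ge0// ler_pdivrMr//.
    by rewrite expr2 [a * B]mulrC -mulrA ler_wpM2l// mulrC.
  apply: le_trans (lerD (lexx _) step); rewrite -subr_ge0.
  rewrite [leRHS](_ : _ = (c * (p - 1) / 2) * ((a - b) * X - 2 * B * p * H * d / (c * (p - 1))) ^+ 2).
    by rewrite mulr_ge0 ?sqr_ge0// divr_ge0// mulr_ge0// ltW.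
  by rewrite /d; field; rewrite !gt_eqF.
have := @ler_wpM2l _ ((a - b) * B) (mulr_ge0 D0 B0) _ _ sqdiff.
lra.
Qed.

(** Whichever of [a] and [s / l] is larger bounds the product alone. *)
Lemma young_powR_split a s l p : 0 <= a -> 0 <= s -> 0 < l -> 1 < p ->
  a * s `^ (p - 1) <= l `^ (p - 1) * a `^ p + s `^ p / l.
Proof.
move=> a0 s0 l0 p1; have p0 : 0 < p by lra.
have [h|/ltW h] := leP a (s / l).
  apply: le_trans (_ : s `^ p / l <= _); last by rewrite lerDr mulr_ge0 ?powR_ge0.
  by rewrite -(@mulr_powRB1 _ s p)// mulrAC ler_wpM2r// powR_ge0.
apply: le_trans (_ : l `^ (p - 1) * a `^ p <= _); last first.
  by rewrite lerDl divr_ge0 ?powR_ge0// ltW.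
rewrite -(@mulr_powRB1 _ a p)// mulrCA ler_wpM2l// -powRM ?(ltW l0)//.
apply: ge0_ler_powR; rewrite ?nnegrE ?subr_ge0 ?(ltW p1) ?mulr_ge0 ?(ltW l0)//.
by rewrite mulrC -ler_pdivrMr.
Qed.

(** Splitting at height [1 / W] compares powers of a function of mass at most
    one against a volume [W]: below that height one factor is kept to be summed as
    mass, above it the power can be raised.  The next two bounds use the same
    split. *)
Lemma powR_le_truncation s W p q : 0 <= s -> 0 < W -> 1 < p -> p <= q ->
  s `^ p <= s * W `^ (1 - p) + W `^ (q - p) * s `^ q.
Proof.
move=> s0 W0 p1 pq; have p0 : 0 < p by lra.
have Wi : 0 < W^-1 by rewrite invr_gt0.
have [h|h] := leP s W^-1.
  apply: le_trans (_ : s * W `^ (1 - p) <= _); last by rewrite lerDl mulr_ge0 ?powR_ge0.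
  rewrite -(@mulr_powRB1 _ s p)// ler_wpM2l// (_ : 1 - p = - (p - 1)); last by ring.
  rewrite powRN -powR_inv1 ?powR_ge0// -powRrM mulrC powRrM powR_inv1 ?(ltW W0)//.
  by apply: ge0_ler_powR; rewrite ?nnegrE ?(ltW Wi)//; lra.
apply: le_trans (_ : W `^ (q - p) * s `^ q <= _); last first.
  by rewrite lerDr mulr_ge0 ?powR_ge0.
have sp : 0 < s by exact: lt_trans h.
rewrite (_ : s `^ q = s `^ (q - p) * s `^ p); last first.
  by rewrite -powRD ?(gt_eqF sp) ?implybT// subrK.
rewrite mulrA -powRM ?(ltW W0)// ler_peMl ?powR_ge0//.
rewrite -(powRr0 (W * s)) ler_powR// ?subr_ge0//.
by rewrite mulrC -ler_pdivrMr ?mul1r// ltW.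
Qed.

Lemma powR_compl_le s W p : 0 <= s -> 0 < W -> 1 < p <= 2 ->
  s `^ (2 - p) <= W `^ (p - 2) + s * W `^ (p - 1).
Proof.
move=> s0 W0 /andP[p1 p2].
have Wi : 0 < W^-1 by rewrite invr_gt0.
have [h|h] := leP s W^-1.
  apply: le_trans (_ : W `^ (p - 2) <= _); last by rewrite lerDl mulr_ge0 ?powR_ge0.
  rewrite (_ : p - 2 = - (2 - p)); last by ring.
  rewrite powRN -powR_inv1 ?powR_ge0// -powRrM mulrC powRrM powR_inv1 ?(ltW W0)//.
  by apply: ge0_ler_powR; rewrite ?nnegrE ?(ltW Wi)//; lra.
apply: le_trans (_ : s * W `^ (p - 1) <= _); last by rewrite lerDr powR_ge0.
have sp : 0 < s by exact: lt_trans h.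
rewrite (_ : 2 - p = 1 - (p - 1)); last by ring.
rewrite powRB ?(gt_eqF sp) ?implybT// powRr1// ler_wpM2l//.
rewrite -powR_inv1 ?powR_ge0// -powRrM mulrC powRrM powR_inv1//.
apply: ge0_ler_powR; rewrite ?nnegrE ?invr_ge0 ?(ltW W0) ?subr_ge0 ?(ltW p1)//.
by rewrite -(invrK W) lef_pV2 ?posrE// ltW.
Qed.

Lemma le_quarter_truncation s W q : 0 <= s -> 0 < W -> 1 < q ->
  s <= (4 * W)^-1 + (4 * W) `^ (q - 1) * s `^ q.
Proof.
move=> s0 W0 q1; have V0 : 0 < 4 * W by rewrite mulr_gt0.
move: (4 * W) V0 => V V0.
have [h|h] := leP s V^-1; first by rewrite ler_wpDr// mulr_ge0 ?powR_ge0.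
rewrite ler_wpDl// ?invr_ge0 ?(ltW V0)//.
have q0 : 0 < q by lra.
rewrite -(@mulr_powRB1 _ s q)// mulrCA ler_peMr//.
rewrite -powRM// ?(ltW V0)// -[leLHS](powRr0 (V * s)) ler_powR// ?subr_ge0 ?(ltW q1)//.
by rewrite mulrC -ler_pdivrMr ?mul1r// ltW.
Qed.

End ScalarInequalities.

(** * Calculus on the real line *)

Section Calculus.
Context {R : realType}.
Implicit Types (f g : R -> R) (t : R).

Lemma is_derive_sum_seq (I : eqType) (s : seq I) (F : I -> R -> R) (dF : I -> R) t :
  (forall i, i \in s -> is_derive t 1 (F i) (dF i)) ->
  is_derive t 1 (fun r => \sum_(i <- s) F i r) (\sum_(i <- s) dF i).
Proof.
elim: s => [|i s IH] dFs.
  rewrite big_nil; under eq_fun do rewrite big_nil; exact: is_derive_cst.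
rewrite big_cons; under eq_fun do rewrite big_cons.
apply: is_deriveD; first by apply: dFs; rewrite mem_head.
by apply: IH => j js; apply: dFs; rewrite inE js orbT.
Qed.

Lemma cvg_sum_seq (I : eqType) (T : Type) (F : set_system T) {FF : Filter F}
    (s : seq I) (f : I -> T -> R) (l : I -> R) :
  (forall i, i \in s -> f i x @[x --> F] --> l i) ->
  \sum_(i <- s) f i x @[x --> F] --> \sum_(i <- s) l i.
Proof.
elim: s => [|i s IH] fl.
  by rewrite big_nil; under eq_fun do rewrite big_nil; exact: cvg_cst.
rewrite big_cons; under eq_fun do rewrite big_cons.
apply: cvgD; first by apply: fl; rewrite mem_head.
by apply: IH => j js; apply: fl; rewrite inE js orbT.
Qed.

Lemma is_derive_comp f g t (df dg : R) :
  is_derive t 1 g dg -> is_derive (g t) 1 f df ->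
  is_derive t 1 (fun r => f (g r)) (df * dg).
Proof.
move=> dgt dft; have dg1 : derivable g t 1 := @ex_derive _ _ _ _ _ _ _ dgt.
have df1 : derivable f (g t) 1 := @ex_derive _ _ _ _ _ _ _ dft.
apply: DeriveDef.
  apply/derivable1_diffP.
  have /derivable1_diffP dg2 := dg1; have /derivable1_diffP df2 := df1.
  exact: (differentiable_comp dg2 df2).
rewrite -derive1E (derive1_comp dg1 df1) !derive1E.
by rewrite (@derive_val _ _ _ _ _ _ _ dgt) (@derive_val _ _ _ _ _ _ _ dft).
Qed.

Lemma is_derive_powR_comp g t (dg p : R) :
  is_derive t 1 g dg -> 0 < g t ->
  is_derive t 1 (fun r => g r `^ p) (p * g t `^ (p - 1) * dg).
Proof.
move=> dgt gt0.
exact: (@is_derive_comp (fun x => x `^ p) g t _ _ dgt (is_derive1_powR p gt0)).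
Qed.

Lemma is_derive_continuous f t (df : R) : is_derive t 1 f df -> {for t, continuous f}.
Proof.
move=> dft; apply: differentiable_continuous; apply/derivable1_diffP.
exact: (@ex_derive _ _ _ _ _ _ _ dft).
Qed.

(** The square removes the corner of the negative part, so that the energy of
    the negative part of a solution can be differentiated. *)
Lemma is_derive_sqr_min0 t :
  is_derive t 1 (fun r : R => Num.min r 0 ^+ 2) (2 * Num.min t 0).
Proof.
have [t0|t0|->] := ltgtP t 0.
- apply: (@near_eq_is_derive _ _ _ (fun r : R => r ^+ 2)).
    near=> r; rewrite min_l//; apply/ltW; near: r; exact: lt_nbhsl.
  by apply: is_derive_eq; rewrite /GRing.scale/= mulr1 -mulr2n mulr_natl.
- apply: (@near_eq_is_derive _ _ _ (cst (0 : R))); last first.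
    by rewrite mulr0; exact: is_derive_cst.
  near=> r; rewrite min_r ?expr0n//; apply/ltW; near: r; exact: lt_nbhsr.
- have d0 : (fun h : R => h^-1 *: (((fun r : R => Num.min r 0 ^+ 2) \o shift 0) (h *: 1)
      - Num.min (0 : R) 0 ^+ 2)) @ 0^' --> (0 : R).
    apply: (@cvg_trans _ ((fun h : R => Num.min h 0) @ 0^')).
      apply: near_eq_cvg; near=> h.
      have h0 : h != 0 by near: h; exact: nbhs_dnbhs_neq.
      rewrite /= addr0 minxx expr0n/= subr0 /GRing.scale/= mulr1 minEle.
      by case: ifPn => _; [rewrite expr2 mulKf|rewrite expr0n mulr0].
    apply/cvgrPdist_le => e e0; near=> h; rewrite sub0r normrN.
    have he : `|h| <= e.
      near: h; apply: dnbhs0_le; exact: e0.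
    by apply: le_trans he; rewrite minEle; case: ifPn => //; rewrite normr0.
  rewrite mulr0; apply: DeriveDef; first by apply/cvg_ex; exists 0.
  exact/cvg_lim.
Unshelve. all: by end_near. Qed.

Lemma derive_ge0_le f (df : R -> R) a b : a <= b ->
  {within `[a, b], continuous f} ->
  (forall t, a < t < b -> is_derive t 1 f (df t)) ->
  (forall t, a < t < b -> 0 <= df t) -> f a <= f b.
Proof.
move=> ab cf dfE df0.
move: ab cf dfE df0; rewrite le_eqVlt => /predU1P[->//|ab] cf dfE df0.
have dfE' x : x \in `]a, b[%R -> is_derive x 1 f (df x) by rewrite in_itv/=; exact: dfE.
have [c] := MVT ab dfE' cf; rewrite in_itv/= => cab fE.
by rewrite -subr_ge0 fE mulr_ge0 ?df0// subr_ge0 ltW.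
Qed.

(** Differential inequalities are integrated below by comparing derivatives;
    this primitive is where a Lebesgue integral enters. *)
Lemma primitive_on_itv g (T : R) : 0 < T -> {within `[0, T], continuous g} ->
  exists J : R -> R, [/\ J 0 = 0, {within `[0, T], continuous J},
    forall t, 0 < t < T -> is_derive t 1 J (g t)
    & (\int[lebesgue_measure]_(t in `[0%R, T]) (g t)%:E = (J T)%:E)%E].
Proof.
move=> T0 cg.
have gi : (@lebesgue_measure R).-integrable `[0, T] (EFin \o g).
  by apply: continuous_compact_integrable => //; exact: segment_compact.
exists (fun x => parameterized_integral (@lebesgue_measure R) 0 x g); split.
- by rewrite /parameterized_integral set_itv1 Rintegral_set1.
- by apply: parameterized_integral_continuous => //; exact: ltW.
- move=> t /andP[t0 tT].
  have ct : {for t, continuous g}.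
    by apply: (within_continuous_continuous T0 cg); rewrite in_itv/= t0.
  have [dJ JE] := @continuous_FTC1_closed R g 0 t T tT gi t0 ct.
  by apply: (DeriveDef dJ); rewrite -derive1E; exact: JE.
- rewrite /parameterized_integral /Rintegral fineK//.
  exact: integrable_fin_num.
Qed.

End Calculus.

(** * Dirichlet form and Dirichlet semigroup *)

Section FiniteSums.
Context {R : realType} {V : choiceType}.

Lemma ler_sum_fsubset (A B : {fset V}) (F : V -> R) :
  (A `<=` B)%fset -> (forall x, 0 <= F x) -> \sum_(x <- A) F x <= \sum_(x <- B) F x.
Proof.
move=> AB F0; rewrite [leRHS](big_fsetID _ (mem A)) /=.
rewrite (_ : [fset x in B | (fun y => y \in A) x]%fset = A) ?lerDl ?sumr_ge0//.
apply/fsetP => x; rewrite !inE/= andb_idl//; exact: (fsubsetP AB).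
Qed.

Lemma ler_sum_fsupport (A B : {fset V}) (F : V -> R) :
  (forall x, 0 <= F x) -> (forall x, x \notin B -> F x = 0) ->
  \sum_(x <- A) F x <= \sum_(x <- B) F x.
Proof.
move=> F0 FB; rewrite [leRHS](@big_fset_incl _ _ _ _ B (A `|` B)%fset) ?fsubsetUr//.
  exact: ler_sum_fsubset (fsubsetUl _ _) F0.
by move=> x _ /FB.
Qed.

End FiniteSums.

Section DirichletForm.
Context {R : realType} {V : choiceType} (G : wgraph R V).
Implicit Types (D : set V) (f g : V -> R) (x y : V).

(** All sums run over [D] together with its neighbours.  For functions that
    vanish off [D] this finite set sees every edge that matters, including those
    through which mass leaves [D]. *)
Definition closed_nbhd D : {fset V} := fset_set (D `|` \bigcup_(x in D) nbr G x).

Lemma finite_closed_nbhd D : finite_set D ->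
  finite_set (D `|` \bigcup_(x in D) nbr G x).
Proof.
move=> Dfin; rewrite finite_setU; split=> //; apply: bigcup_finite => // x _.
exact: adj_locally_finite.
Qed.

Lemma mem_closed_nbhd D x : finite_set D -> D x -> x \in closed_nbhd D.
Proof.
move=> Dfin Dx; rewrite in_fset_set; last exact: finite_closed_nbhd.
by apply/mem_set; left.
Qed.

Lemma adj_closed_nbhd D x y : finite_set D -> D x -> adj G x y -> y \in closed_nbhd D.
Proof.
move=> Dfin Dx xy; rewrite in_fset_set; last exact: finite_closed_nbhd.
by apply/mem_set; right; exists x.
Qed.

(** Each edge is counted in both directions, whence the factor [2^-1] in
    Green's formula. *)
Definition dform (E : {fset V}) f g : R :=
  \sum_(x <- E) \sum_(y <- E) edge_weight G x y * ((f x - f y) * (g x - g y)).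

Lemma nu_laplacian D f x : finite_set D -> D x ->
  nu G x * laplacian G f x =
  \sum_(y <- closed_nbhd D) edge_weight G x y * (f y - f x).
Proof.
move=> Dfin Dx; rewrite laplacianE mulVKf ?gt_eqF ?nu_gt0//.
apply: big_fset_incl.
  apply/fsubsetP => y; rewrite in_fset_set; last exact: adj_locally_finite.
  by move=> /set_mem xy; exact: adj_closed_nbhd xy.
move=> y _; rewrite in_fset_set; last exact: adj_locally_finite.
move=> xy; rewrite edge_weight_eq0 ?mul0r//; apply/negP => h; move/negP: xy; apply.
exact/mem_set.
Qed.

(** Antisymmetrising [w x y * (f y - f x) * g x] in the two ends of the edge
    gives the Dirichlet form. *)
Lemma green_formula D f g : finite_set D -> (forall x, ~ D x -> g x = 0) ->
  \sum_(x <- closed_nbhd D) nu G x * g x * laplacian G f x =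
  - (2^-1 * dform (closed_nbhd D) f g).
Proof.
move=> Dfin g0; rewrite /dform; set E := closed_nbhd D.
have -> : \sum_(x <- E) nu G x * g x * laplacian G f x =
    \sum_(x <- E) \sum_(y <- E) edge_weight G x y * ((f y - f x) * g x).
  apply: eq_bigr => x _; have [Dx|Dx] := pselect (D x); last first.
    by rewrite g0// mulr0 mul0r big1// => y _; rewrite mulr0 mulr0.
  rewrite mulrAC (nu_laplacian _ Dfin Dx) mulr_suml.
  by apply: eq_bigr => y _; rewrite mulrA.
set S := \sum_(x <- E) _.
suff -> : \sum_(x <- E) \sum_(y <- E) edge_weight G x y * ((f x - f y) * (g x - g y)) = - S - S.
  by rewrite -opprD -mulr2n -[S *+ 2]mulr_natl mulrN mulKf ?opprK ?pnatr_eq0.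
have SE : S = \sum_(x <- E) \sum_(y <- E) edge_weight G x y * ((f x - f y) * g y).
  rewrite /S exchange_big/=; apply: eq_bigr => x _; apply: eq_bigr => y _.
  by rewrite (edge_weight_sym G y x).
rewrite -opprD {2}SE /S -big_split/= -sumrN; apply: eq_bigr => x _.
rewrite -big_split/= -sumrN; apply: eq_bigr => y _; ring.
Qed.

Lemma dform_sym E f g : dform E f g = dform E g f.
Proof. by do 2![apply: eq_bigr => ? _]; congr (_ * _); rewrite mulrC. Qed.

Lemma adapted_sum_le (rho : V -> V -> R) (E : {fset V}) x : adapted G rho ->
  \sum_(y <- E) edge_weight G x y * rho x y ^+ 2 <= nu G x.
Proof.
move=> /(_ x); rewrite fsbig_finite; last exact: adj_locally_finite.
apply: le_trans; apply: ler_sum_fsupport.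
  by move=> y; rewrite mulr_ge0 ?edge_weight_ge0 ?sqr_ge0.
move=> y; rewrite in_fset_set; last exact: adj_locally_finite.
move=> xy; rewrite edge_weight_eq0 ?mul0r//; apply/negP => h; move/negP: xy; apply.
exact/mem_set.
Qed.

End DirichletForm.

Section Semigroup.
Context {R : realType} {V : choiceType} (G : wgraph R V).
Variables (D : set V) (Dfin : finite_set D).
Implicit Types (f g : V -> R) (x y : V).

Local Notation L := (dirichlet_laplacian G D).
Local Notation E := (closed_nbhd G D).

Lemma ext0_id f : (forall x, ~ D x -> f x = 0) -> ext0 D f = f.
Proof.
by move=> f0; apply/funext => x; rewrite ext0E; case: ifPn => // /negP xD;
  rewrite f0// => Dx; apply: xD; exact/mem_set.
Qed.

Lemma ext0_out f x : ~ D x -> ext0 D f x = 0.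
Proof. by move=> Dx; rewrite ext0E memNset. Qed.

Lemma ext0_in f x : D x -> ext0 D f x = f x.
Proof. by move=> Dx; rewrite ext0E mem_set. Qed.

Lemma iter_dirichlet_out f k x : ~ D x -> iter k L (ext0 D f) x = 0.
Proof. by case: k => [|k] Dx /=; exact: ext0_out. Qed.

Lemma dirichlet_selfadjoint f g :
  (forall x, ~ D x -> f x = 0) -> (forall x, ~ D x -> g x = 0) ->
  \sum_(x <- E) nu G x * g x * L f x = \sum_(x <- E) nu G x * f x * L g x.
Proof.
have LE h h' : (forall x, ~ D x -> h x = 0) -> (forall x, ~ D x -> h' x = 0) ->
    \sum_(x <- E) nu G x * h x * L h' x = \sum_(x <- E) nu G x * h x * laplacian G h' x.
  move=> h0 h'0; apply: eq_bigr => x _; have [Dx|Dx] := pselect (D x).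
    by rewrite /dirichlet_laplacian ext0_in// ext0_id.
  by rewrite h0// mulr0 !mul0r.
by move=> f0 g0; rewrite !LE// !green_formula// dform_sym.
Qed.

Lemma iter_dirichlet_selfadjoint f g k :
  (forall x, ~ D x -> f x = 0) -> (forall x, ~ D x -> g x = 0) ->
  \sum_(x <- E) nu G x * g x * iter k L f x = \sum_(x <- E) nu G x * f x * iter k L g x.
Proof.
have iter0 h j : (forall x, ~ D x -> h x = 0) -> forall x, ~ D x -> iter j L h x = 0.
  by move=> h0 x Dx; rewrite -(ext0_id h0) iter_dirichlet_out.
elim: k f g => [|k IH] f g f0 g0.
  by apply: eq_bigr => x _ /=; rewrite mulrAC.
rewrite iterS dirichlet_selfadjoint//; last exact: iter0.
rewrite -[RHS](_ : \sum_(x <- E) nu G x * f x * iter k L (L g) x = _); last first.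
  by apply: eq_bigr => x _; rewrite -iterSr.
rewrite -(IH f (L g))//; last by move=> x Dx; exact: ext0_out.
by apply: eq_bigr => x _; rewrite mulrAC.
Qed.

Lemma sum_indic_closed_nbhd o (h : V -> R) : D o ->
  \sum_(x <- E) nu G x * ext0 D \1_[set o] x * h x = nu G o * h o.
Proof.
move=> Do; rewrite (big_fsetD1 o) /=; last exact: mem_closed_nbhd.
rewrite ext0_in// indicE mem_set// mulr1 big_seq big1 ?addr0// => x.
rewrite !inE => /andP[xo _]; have [Dx|Dx] := pselect (D x).
  by rewrite ext0_in// indicE memNset ?mulr0 ?mul0r//= => xE; rewrite xE eqxx in xo.
by rewrite ext0_out// mulr0 mul0r.
Qed.

(** The kernel is defined by evaluating at [o] the semigroup applied to the
    indicator of [x].  This symmetry, a consequence of self-adjointness with respect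
    to [nu], allows it to be regarded as a solution of the heat equation in [x]. *)
Lemma iter_dirichlet_kernel_sym o x k : D o -> D x ->
  nu G o * iter k L (ext0 D \1_[set x]) o = nu G x * iter k L (ext0 D \1_[set o]) x.
Proof.
move=> Do Dx; rewrite -!sum_indic_closed_nbhd//.
by apply: iter_dirichlet_selfadjoint => y Dy; exact: ext0_out.
Qed.

Lemma dirichlet_heat_kernelE o x t : D o ->
  dirichlet_heat_kernel G D t o x = ext0 D (dirichlet_semigroup G D t \1_[set o]) x / nu G o.
Proof.
move=> Do; rewrite /dirichlet_heat_kernel; have [Dx|Dx] := pselect (D x); last first.
  rewrite ext0_out// mul0r /dirichlet_semigroup.
  have -> : ext0 D \1_[set x] = (fun=> 0 : R).
    apply/funext => y; have [Dy|Dy] := pselect (D y); last by rewrite ext0_out.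
    by rewrite ext0_in// indicE memNset//= => yx; apply: Dx; rewrite -yx.
  have L0 k : iter k L (fun=> 0 : R) = fun=> 0.
    elim: k => //= k ->; apply/funext => y; rewrite /dirichlet_laplacian ext0E.
    case: ifP => // _; rewrite ext0_id// laplacianE big1 ?mulr0// => z _.
    by rewrite subrr mulr0.
  rewrite (_ : series _ = fun=> 0) ?lim_cst ?mul0r//; apply/funext => n.
  by rewrite /series/= big1// => k _; rewrite L0 mulr0.
rewrite ext0_in// /dirichlet_semigroup.
have co := @is_cvg_dirichlet_semigroup _ _ G D t \1_[set o] x Dfin.
rewrite (_ : series _ = (fun n => nu G x / nu G o * series (fun k => exp_coeff t k *
  iter k L (ext0 D \1_[set o]) x) n)); last first.
  apply/funext => n; rewrite /series/= mulr_sumr; apply: eq_bigr => k _.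
  rewrite -[iter k L _ o](mulKf (lt0r_neq0 (nu_gt0 G o))) iter_dirichlet_kernel_sym//.
  by field; rewrite gt_eqF ?nu_gt0.
rewrite limM//; last exact: is_cvg_cst.
by rewrite lim_cst//; field; rewrite !gt_eqF ?nu_gt0.
Qed.

Lemma dirichlet_semigroup_out f t x : ~ D x -> dirichlet_semigroup G D t f x = 0.
Proof.
move=> Dx; rewrite /dirichlet_semigroup (_ : series _ = fun=> 0) ?lim_cst//.
by apply/funext => n; rewrite /series/= big1// => k _; rewrite iter_dirichlet_out// mulr0.
Qed.

Lemma dirichlet_laplacian_series f (a : nat -> R) n x :
  \sum_(0 <= k < n) a k * iter k L (L (ext0 D f)) x =
  L (fun y => \sum_(0 <= k < n) a k * iter k L (ext0 D f) y) x.
Proof.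
have [Dx|Dx] := pselect (D x); last first.
  rewrite [RHS]ext0_out// big1// => k _.
  by rewrite -iterSr iter_dirichlet_out// mulr0.
have Llap h : (forall y, ~ D y -> h y = 0) -> L h x = laplacian G h x.
  by move=> h0; rewrite /dirichlet_laplacian ext0_in// ext0_id.
rewrite Llap; last first.
  by move=> y Dy; rewrite big1// => k _; rewrite iter_dirichlet_out// mulr0.
under eq_bigr => k _.
  rewrite -iterSr iterS Llap; last by move=> y; exact: iter_dirichlet_out.
  rewrite laplacianE mulrCA; over.
rewrite -mulr_sumr [RHS]laplacianE; congr (_ * _).
under eq_bigr do rewrite mulr_sumr.
rewrite exchange_big/=; apply: eq_bigr => y _; rewrite -sumrB mulr_sumr.
by apply: eq_bigr => k _; ring.
Qed.

(** The operator involves finitely many values of its argument. *)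
Lemma dirichlet_laplacian_cvg (g_ : nat -> V -> R) g x :
  (forall y, g_ ^~ y @ \oo --> g y) -> (fun n => L (g_ n) x) @ \oo --> L g x.
Proof.
move=> gg; have [Dx|Dx] := pselect (D x); last first.
  rewrite [L g x]ext0_out//; under eq_fun do rewrite [L _ _]ext0_out//.
  exact: cvg_cst.
have LE h : L h x = (nu G x)^-1 * \sum_(y <- fset_set (nbr G x))
    edge_weight G x y * (ext0 D h y - ext0 D h x).
  by rewrite [LHS]ext0_in// laplacianE.
rewrite LE (_ : (fun n => _) = fun n => (nu G x)^-1 * \sum_(y <- fset_set (nbr G x))
    edge_weight G x y * (ext0 D (g_ n) y - ext0 D (g_ n) x)); last by apply/funext.
have ext_cvg y : ext0 D (g_ n) y @[n --> \oo] --> ext0 D g y.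
  have [Dy|Dy] := pselect (D y).
    by rewrite ext0_in//; under eq_fun do rewrite ext0_in//; exact: gg.
  by rewrite ext0_out//; under eq_fun do rewrite ext0_out//; exact: cvg_cst.
apply: cvgMl_tmp; apply: cvg_sum_seq => y _.
by apply: cvgMl_tmp; apply: cvgB.
Qed.

Lemma dirichlet_semigroup_generator f t x :
  dirichlet_semigroup G D t (L (ext0 D f)) x = L (dirichlet_semigroup G D t f) x.
Proof.
apply/cvg_lim => //.
rewrite ext0_id; last by move=> y; exact: ext0_out.
rewrite (_ : series _ = fun n => L (fun y => series (fun k => exp_coeff t k *
    iter k L (ext0 D f) y) n) x); last first.
  by apply/funext => n; rewrite /series/= dirichlet_laplacian_series.
by apply: dirichlet_laplacian_cvg => y; exact: is_cvg_dirichlet_semigroup.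
Qed.

(** The exponential series is a power series in [t], and differentiating it
    shifts the iterates of the operator by one. *)
Lemma is_derive_dirichlet_semigroup f (t : R) x :
  is_derive t 1 (fun s => dirichlet_semigroup G D s f x)
    (L (dirichlet_semigroup G D t f) x).
Proof.
have serE h s : ext0 D h = h -> series (fun k => exp_coeff s k * iter k L h x) =
    pseries (fun k => (k`!%:R)^-1 * iter k L h x) s.
  move=> hE; apply/funext => n; rewrite /pseries/series/=; apply: eq_bigr => k _.
  by rewrite /exp_coeff /= -mulrA mulrC.
have diffE h : pseries_diffs (fun k => (k`!%:R)^-1 * iter k L h x) =
    (fun k => (k`!%:R)^-1 * iter k L (L h) x) :> (nat -> R).
  apply/funext => k; rewrite /pseries_diffs -iterSr factS natrM invfM mulrA mulVKf//.
have semE h s : ext0 D h = h ->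
    dirichlet_semigroup G D s h x = limn (pseries (fun k => (k`!%:R)^-1 * iter k L h x) s).
  by move=> hE; rewrite /dirichlet_semigroup hE serE.
have cvgE h s : ext0 D h = h -> cvgn (pseries (fun k => (k`!%:R)^-1 * iter k L h x) s).
  move=> hE; have := @is_cvg_dirichlet_semigroup _ _ G D s h x Dfin.
  by rewrite hE serE.
have extL h : ext0 D (L h) = L h by apply: ext0_id => y; exact: ext0_out.
have ext2 : ext0 D (ext0 D f) = ext0 D f by apply: ext0_id => y; exact: ext0_out.
have semf s : dirichlet_semigroup G D s f x = dirichlet_semigroup G D s (ext0 D f) x.
  by rewrite /dirichlet_semigroup ext2.
rewrite -dirichlet_semigroup_generator.
under eq_fun do rewrite semf semE//.
rewrite semE// -diffE.
apply: (@pseries_snd_diffs _ _ (`|t| + 1)); rewrite ?diffE.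
- exact: cvgE.
- exact: cvgE.
- exact: cvgE.
- by rewrite [ltRHS]ger0_norm ?addr_ge0// ltrDl.
Qed.

End Semigroup.

(** * Maximum principle and the Dirichlet heat kernel *)

Section MaximumPrinciple.
Context {R : realType} {V : choiceType} (G : wgraph R V).
Variables (D : set V) (Dfin : finite_set D).

Lemma sum_fset_set_closed_nbhd (F : V -> R) : (forall x, ~ D x -> F x = 0) ->
  \sum_(x <- fset_set D) F x = \sum_(x <- closed_nbhd G D) F x.
Proof.
move=> F0; apply: big_fset_incl.
  apply/fsubsetP => x; rewrite in_fset_set// => /set_mem Dx; exact: mem_closed_nbhd.
by move=> x _; rewrite in_fset_set// => Dx; apply: F0 => /mem_set; exact/negP.
Qed.

Lemma mem_fset_set_sub x : x \in fset_set D -> D x.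
Proof. by rewrite in_fset_set// => /set_mem. Qed.

(** The energy [sum nu (min w 0)^2] does not increase: by Green's formula its
    derivative is minus a Dirichlet form of [w] against a nondecreasing function
    of [w].  It vanishes at time 0, hence always. *)
Lemma dirichlet_maximum_principle (w : R -> V -> R) :
  (forall (t : R) x, 0 <= t -> D x -> is_derive t 1 (w ^~ x) (laplacian G (w t) x)) ->
  (forall t x, 0 <= t -> ~ D x -> 0 <= w t x) ->
  (forall x, D x -> 0 <= w 0 x) ->
  forall t x, 0 <= t -> 0 <= w t x.
Proof.
move=> dw w_out w0 t x t0; have [Dx|] := pselect (D x); last exact: w_out.
pose N s : R := \sum_(y <- fset_set D) nu G y * Num.min (w s y) 0 ^+ 2.
pose dN s : R := \sum_(y <- fset_set D)
   nu G y * (2 * Num.min (w s y) 0 * laplacian G (w s) y).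
have dNE (s : R) : 0 <= s -> is_derive s 1 N (dN s).
  move=> s0; apply: is_derive_sum_seq => y /mem_fset_set_sub Dy.
  apply: is_deriveZ; apply: (@is_derive_comp _ (fun r : R => Num.min r 0 ^+ 2)).
    exact: dw.
  exact: is_derive_sqr_min0.
have dN0 s : 0 <= s -> dN s <= 0.
  move=> s0; pose g y := Num.min (w s y) 0.
  have g0 y : ~ D y -> g y = 0 by move=> Dy; rewrite /g min_r// w_out.
  rewrite /dN (eq_bigr (fun y => 2 * (nu G y * g y * laplacian G (w s) y))); last first.
    by move=> y _; rewrite /g; ring.
  rewrite -mulr_sumr sum_fset_set_closed_nbhd; last first.
    by move=> y Dy; rewrite g0// mulr0 mul0r.
  rewrite green_formula// mulrN mulVKf// oppr_le0.
  apply: sumr_ge0 => y _; apply: sumr_ge0 => z _; apply: mulr_ge0.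
    exact: edge_weight_ge0.
  rewrite /g; have [yz|/ltW zy] := leP (w s y) (w s z).
    by rewrite mulr_le0// subr_le0// le_min2.
  by rewrite mulr_ge0 ?subr_ge0// le_min2.
have N0 : N 0 = 0.
  rewrite /N big_seq big1// => y /mem_fset_set_sub Dy.
  by rewrite min_r ?w0// expr0n mulr0.
have Nt : N t <= 0.
  rewrite -N0 -lerN2.
  apply: (@derive_ge0_le _ (fun s => - N s) (fun s => - dN s)) => //.
  - apply: derivable_within_continuous => s; rewrite in_itv/= => /andP[s0 _].
    exact: (@ex_derive _ _ _ _ _ _ _ (is_deriveN (dNE s s0))).
  - by move=> s /andP[/ltW s0 _]; apply: is_deriveN; exact: dNE.
  - by move=> s /andP[/ltW s0 _]; rewrite oppr_ge0 dN0.
have : nu G x * Num.min (w t x) 0 ^+ 2 <= 0.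
  apply: le_trans Nt; rewrite /N (big_fsetD1 x)/= ?in_fset_set ?mem_set//.
  by rewrite lerDl sumr_ge0// => y _; rewrite mulr_ge0 ?sqr_ge0// ltW// nu_gt0.
rewrite pmulr_rle0 ?nu_gt0// => h.
have /eqP : Num.min (w t x) 0 ^+ 2 = 0 by apply/eqP; rewrite eq_le h sqr_ge0.
by rewrite sqrf_eq0 => /eqP minE; rewrite -minE ge_min lexx.
Qed.

End MaximumPrinciple.

Section DirichletHeatKernel.
Context {R : realType} {V : choiceType} (G : wgraph R V).
Variables (D : set V) (Dfin : finite_set D) (o : V) (Do : D o).

Local Notation u t := (dirichlet_heat_kernel G D t o).
Local Notation E := (closed_nbhd G D).

Lemma heat_out (t : R) x : ~ D x -> u t x = 0.
Proof. by move=> Dx; rewrite dirichlet_heat_kernelE// ext0_out// mul0r. Qed.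

Lemma heatE (t : R) : u t = fun x => dirichlet_semigroup G D t \1_[set o] x / nu G o.
Proof.
apply/funext => x; rewrite dirichlet_heat_kernelE//.
have [Dx|Dx] := pselect (D x); first by rewrite ext0_in.
by rewrite ext0_out// dirichlet_semigroup_out.
Qed.

Lemma is_derive_heat (t : R) x : D x ->
  is_derive t 1 (fun s => u s x) (laplacian G (u t) x).
Proof.
move=> Dx; have h := @is_derive_dirichlet_semigroup _ _ G D Dfin \1_[set o] t x.
under eq_fun do rewrite heatE mulrC.
have -> : laplacian G (u t) x =
    (nu G o)^-1 * dirichlet_laplacian G D (dirichlet_semigroup G D t \1_[set o]) x.
  rewrite /dirichlet_laplacian ext0_in// ext0_id; last first.
    by move=> y; exact: dirichlet_semigroup_out.
  rewrite heatE !laplacianE mulrCA; congr (_ * _); rewrite mulr_sumr.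
  by apply: eq_bigr => y _; ring.
exact: is_deriveZ.
Qed.

Lemma heat0 x : u 0 x = if x == o then (nu G o)^-1 else 0.
Proof.
have [->{x}|xo] := eqVneq x o.
  rewrite heatE (_ : dirichlet_semigroup _ _ _ _ _ = 1) ?mul1r//.
  apply/cvg_lim => //; apply: cvg_near_cst; near=> n.
  have [m ->] : exists m, n = m.+1 by exists n.-1; rewrite prednK//; near: n; exists 1%N.
  rewrite /series/= big_nat_recl//= big1 ?addr0.
    by rewrite /exp_coeff/= expr0 mul1r fact0 invr1 mul1r ext0_in// indicE mem_set.
  by move=> k _; rewrite /exp_coeff /= exprS !mul0r.
rewrite heatE (_ : dirichlet_semigroup _ _ _ _ _ = 0) ?mul0r//.
apply/cvg_lim => //; apply: cvg_near_cst; near=> n.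
rewrite /series/= big1// => -[|k] _; last by rewrite /exp_coeff /= exprS !mul0r.
rewrite /= ext0E; case: ifP => _; rewrite ?mulr0// indicE memNset ?mulr0//=.
exact/eqP.
Unshelve. all: by end_near. Qed.

Lemma heat_ge0 (t : R) x : 0 <= t -> 0 <= u t x.
Proof.
move=> t0; apply: (@dirichlet_maximum_principle _ _ G D Dfin (fun s => u s)) => //.
- by move=> s y _ Dy; exact: is_derive_heat.
- by move=> s y _ Dy; rewrite heat_out.
- by move=> y _; rewrite heat0; case: ifP => // _; rewrite invr_ge0 ltW// nu_gt0.
Qed.

(** Mass only leaves [D]: Green's formula against the indicator of [D] leaves
    the edges joining [D] to its complement. *)
Lemma heat_mass_le1 (t : R) : 0 <= t -> \sum_(x <- E) nu G x * u t x <= 1.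
Proof.
move=> t0; rewrite -(sum_fset_set_closed_nbhd G Dfin)//; last first.
  by move=> x Dx; rewrite heat_out// mulr0.
pose N s : R := \sum_(x <- fset_set D) nu G x * u s x.
pose dN s : R := \sum_(x <- fset_set D) nu G x * laplacian G (u s) x.
have dNE (s : R) : is_derive s 1 N (dN s).
  apply: is_derive_sum_seq => y /(mem_fset_set_sub Dfin) Dy.
  by apply: is_deriveZ; exact: is_derive_heat.
have dN0 s : 0 <= s -> dN s <= 0.
  move=> s0; rewrite /dN.
  have -> : \sum_(x <- fset_set D) nu G x * laplacian G (u s) x =
      \sum_(x <- fset_set D) nu G x * \1_D x * laplacian G (u s) x.
    apply: eq_big_seq => y /(mem_fset_set_sub Dfin) Dy.
    by rewrite indicE mem_set// mulr1.
  have D0 y : ~ D y -> \1_D y = 0 :> R by move=> Dy; rewrite indicE memNset.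
  rewrite (sum_fset_set_closed_nbhd G Dfin)//; last by move=> y Dy; rewrite D0// mulr0 mul0r.
  rewrite green_formula// oppr_le0 mulr_ge0//.
  apply: sumr_ge0 => y _; apply: sumr_ge0 => z _; apply: mulr_ge0.
    exact: edge_weight_ge0.
  rewrite !indicE; have [Dy|Dy] := pselect (D y); have [Dz|Dz] := pselect (D z).
  - by rewrite !mem_set// subrr mulr0.
  - by rewrite mem_set// memNset// (heat_out _ Dz) !subr0 mulr1 heat_ge0.
  - by rewrite memNset// mem_set// (heat_out _ Dy) !sub0r mulrNN mulr1 heat_ge0.
  - by rewrite !memNset// subrr mulr0.
have N0 : N 0 = 1.
  rewrite /N (big_fsetD1 o)/= ?in_fset_set ?mem_set// heat0 eqxx mulfV ?gt_eqF ?nu_gt0//.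
  rewrite big_seq big1 ?addr0// => x; rewrite !inE => /andP[xo _].
  by rewrite heat0 (negbTE xo) mulr0.
suff : - N 0 <= - N t by rewrite lerN2 N0.
apply: (@derive_ge0_le _ (fun s => - N s) (fun s => - dN s)) => //.
- apply: derivable_within_continuous => s _.
  exact: (@ex_derive _ _ _ _ _ _ _ (is_deriveN (dNE s))).
- by move=> s /andP[/ltW s0 _]; rewrite oppr_ge0 dN0.
Qed.

Lemma heat_le_inv_nu (t : R) x : 0 <= t -> u t x <= (nu G x)^-1.
Proof.
move=> t0; have [Dx|Dx] := pselect (D x); last first.
  by rewrite heat_out// invr_ge0 ltW ?nu_gt0.
rewrite -[leRHS]mul1r ler_pdivlMr ?nu_gt0// mulrC.
apply: le_trans (heat_mass_le1 t0); rewrite (big_fsetD1 x)/=; last exact: mem_closed_nbhd.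
rewrite lerDl; apply: sumr_ge0 => y _.
by apply: mulr_ge0 (ltW (nu_gt0 _ _)) (heat_ge0 _ t0).
Qed.

(** The factor [expR (c * t)], with [c] the total jump rate at [x], cancels the
    diagonal of the Laplacian; only the nonnegative inflow from neighbours
    remains in the derivative, and the mean value theorem gives the formula. *)
Lemma heat_growth x : D x -> exists2 c : R, 0 <= c &
  forall (t : R), 0 < t -> exists2 s, 0 < s < t &
    expR (c * t) * u t x = u 0 x + t * (expR (c * s) *
      ((nu G x)^-1 * \sum_(y <- E) edge_weight G x y * u s y)).
Proof.
move=> Dx; pose c := (nu G x)^-1 * \sum_(y <- E) edge_weight G x y.
have c0 : 0 <= c.
  rewrite mulr_ge0 ?invr_ge0 ?(ltW (nu_gt0 _ _))// sumr_ge0// => y _.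
  exact: edge_weight_ge0.
exists c => // t t0.
have dE (s : R) : is_derive s 1 (fun r => expR (c * r) * u r x) (expR (c * s) *
      ((nu G x)^-1 * \sum_(y <- E) edge_weight G x y * u s y)).
  have d1 : is_derive s 1 (fun r : R => expR (c * r)) (expR (c * s) * c).
    apply: (@is_derive_comp _ (@expR R) (fun r : R => c * r)).
    by apply: is_derive_eq; rewrite /GRing.scale/= mulr1.
  apply: is_derive_eq; first exact: (is_deriveM d1 (is_derive_heat s Dx)).
  rewrite /GRing.scale/= -[laplacian G (u s) x](mulKf (lt0r_neq0 (nu_gt0 G x))).
  rewrite (nu_laplacian G _ Dfin Dx).
  have -> : \sum_(y <- E) edge_weight G x y * (u s y - u s x) =
      \sum_(y <- E) edge_weight G x y * u s y - (\sum_(y <- E) edge_weight G x y) * u s x.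
    by rewrite mulr_suml -sumrB; apply: eq_bigr => y _; ring.
  by rewrite /c; ring.
have [|s] := @MVT _ _ _ _ _ t0 (fun s _ => dE s).
  apply: derivable_within_continuous => s _; exact: (@ex_derive _ _ _ _ _ _ _ (dE s)).
rewrite in_itv/= => s0t; rewrite mulr0 expR0 mul1r subr0 => /eqP.
rewrite subr_eq => /eqP ->; exists s => //.
by rewrite addrC mulrC.
Qed.

Lemma heat_pos_adj x y : D x -> adj G x y ->
  (forall t : R, 0 < t -> 0 < u t y) -> forall t : R, 0 < t -> 0 < u t x.
Proof.
move=> Dx xy uy t t0; have [c c0 /(_ t t0)[s /andP[s0 st] uE]] := heat_growth Dx.
have : 0 < expR (c * t) * u t x.
  rewrite uE ltr_wpDl ?heat_ge0// mulr_gt0// mulr_gt0 ?expR_gt0//.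
  rewrite mulr_gt0 ?invr_gt0 ?nu_gt0// (big_fsetD1 y)/=; last exact: adj_closed_nbhd xy.
  rewrite ltr_wpDr//.
    by rewrite sumr_ge0// => z _; rewrite mulr_ge0 ?edge_weight_ge0 ?heat_ge0// ltW.
  by rewrite mulr_gt0 ?edge_weight_gt0 ?uy.
by rewrite pmulr_rgt0 ?expR_gt0.
Qed.

(** Positivity propagates from [o] along paths inside [D].  It is needed because
    real powers of the solution are differentiated in time. *)
Lemma heat_gt0 (t : R) x : connected_in (adj G) D -> 0 < t -> D x -> 0 < u t x.
Proof.
move=> Dcon t0 Dx; have [p [+ <- pD]] := Dcon o x Do Dx.
have uo : forall t : R, 0 < t -> 0 < u t o.
  move=> r r0; have [c c0 /(_ r r0)[s /andP[s0 st] uE]] := heat_growth Do.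
  have : 0 < expR (c * r) * u r o.
    rewrite uE ltr_wpDr//; last by rewrite heat0 eqxx invr_gt0 nu_gt0.
    rewrite !mulr_ge0 ?expR_ge0 ?invr_ge0 ?(ltW (nu_gt0 _ _)) ?(ltW r0)// sumr_ge0// => z _.
    by rewrite mulr_ge0 ?edge_weight_ge0 ?heat_ge0// ltW.
  by rewrite pmulr_rgt0 ?expR_gt0.
suff main : forall y, (forall r : R, 0 < r -> 0 < u r y) -> (forall z, z \in y :: p -> D z) ->
    path (adj G) y p -> 0 < u t (last y p) by exact: main.
elim: p {pD} => [|z p IH] y uy pD /=; first by move=> _; exact: uy.
move=> /andP[yz zp]; apply: IH zp => //; last first.
  by move=> v vp; apply: pD; rewrite inE vp orbT.
apply: heat_pos_adj uy; first by apply: pD; rewrite !inE eqxx orbT.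
by rewrite adj_sym.
Qed.

End DirichletHeatKernel.

Section DomainMonotonicity.
Context {R : realType} {V : choiceType} (G : wgraph R V).

Lemma dirichlet_heat_kernel_outl (D : set V) (o : V) (t : R) x : ~ D o ->
  dirichlet_heat_kernel G D t o x = 0.
Proof. by move=> Do; rewrite /dirichlet_heat_kernel dirichlet_semigroup_out// mul0r. Qed.

Lemma dirichlet_heat_kernel_mono (D D' : set V) (o : V) (t : R) x :
  finite_set D -> finite_set D' -> D `<=` D' -> 0 <= t ->
  dirichlet_heat_kernel G D t o x <= dirichlet_heat_kernel G D' t o x.
Proof.
move=> Dfin D'fin DD' t0; have [Do|Do] := pselect (D o); last first.
  rewrite dirichlet_heat_kernel_outl//; have [D'o|D'o] := pselect (D' o).
    exact: heat_ge0.
  by rewrite dirichlet_heat_kernel_outl.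
have D'o := DD' _ Do; rewrite -subr_ge0.
apply: (@dirichlet_maximum_principle _ _ G D Dfin (fun s y =>
  dirichlet_heat_kernel G D' s o y - dirichlet_heat_kernel G D s o y)) => //.
- move=> s y _ Dy; have D'y := DD' _ Dy.
  have h := is_deriveB (is_derive_heat G D'fin D'o s D'y) (is_derive_heat G Dfin Do s Dy).
  apply: (is_derive_eq h).
  rewrite !laplacianE -mulrBr -sumrB; congr (_ * _).
  by apply: eq_bigr => z _; ring.
- by move=> s y s0 Dy; rewrite (heat_out G Dfin Do _ Dy)// subr0 heat_ge0.
- by move=> y Dy; rewrite !heat0// subrr.
Qed.

(** Since [nu x * p(t, o, x)] is at most one, the monotone sequence of
    Dirichlet kernels converges, and it lies below its limit. *)
Lemma dirichlet_le_heat_kernel (D : nat -> set V) (o : V) (t : R) x j :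
  exhaustion G D -> 0 <= t ->
  dirichlet_heat_kernel G (D j) t o x <= heat_kernel G D t o x.
Proof.
move=> [Dfc Dmono Dcov] t0; apply: (@nondecreasing_cvgn_le _ (fun j => dirichlet_heat_kernel G (D j) t o x)).
  apply/nondecreasing_seqP => n; apply: dirichlet_heat_kernel_mono => //.
  - by have [] := Dfc n.
  - by have [] := Dfc n.+1.
apply: nondecreasing_is_cvgn.
  apply/nondecreasing_seqP => n; apply: dirichlet_heat_kernel_mono => //.
  - by have [] := Dfc n.
  - by have [] := Dfc n.+1.
exists (nu G x)^-1 => _ [n _ <-]; have [Do|Do] := pselect (D n o); last first.
  by rewrite dirichlet_heat_kernel_outl// invr_ge0 ltW// nu_gt0.
by apply: heat_le_inv_nu => //; have [] := Dfc n.
Qed.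

End DomainMonotonicity.

(** * Energy, moment and flux at a fixed time *)

Section FixedTime.
Context {R : realType} {V : choiceType} (G : wgraph R V).
Variables (E : {fset V}) (e : V -> R) (b : R).
Hypothesis e_ge0 : forall x, 0 <= e x.
Hypothesis e_adapted : forall x,
  \sum_(y <- E) edge_weight G x y * (e x - e y) ^+ 2 <= b * nu G x.
Variable f : V -> R.
Hypothesis f_ge0 : forall x, 0 <= f x.
Implicit Types (h : V -> R) (x y : V).

Local Notation w := (edge_weight G).
Local Notation w_ge0 := (edge_weight_ge0 G).
Let nu_ge0 x : 0 <= nu G x := ltW (nu_gt0 G x).

(** Adaptedness enters the estimates only through this bound and the next one. *)
Lemma adapted_sum_out h : (forall x, 0 <= h x) ->
  \sum_(x <- E) \sum_(y <- E) w x y * ((e x - e y) ^+ 2 * h x) <=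
  b * \sum_(x <- E) nu G x * h x.
Proof.
move=> h0; rewrite mulr_sumr; apply: ler_sum => x _.
under eq_bigr do rewrite mulrA; rewrite -mulr_suml mulrA.
by apply: ler_wpM2r.
Qed.

Lemma adapted_sum_in h : (forall x, 0 <= h x) ->
  \sum_(x <- E) \sum_(y <- E) w x y * ((e x - e y) ^+ 2 * h y) <=
  b * \sum_(x <- E) nu G x * h x.
Proof.
move=> h0; apply: le_trans (adapted_sum_out h0); rewrite exchange_big/=.
apply: ler_sum => x _; apply: ler_sum => y _.
by rewrite (edge_weight_sym G y x) -[e y - e x]opprB sqrrN.
Qed.

Variable p : R.
Hypothesis p12 : 1 < p <= 2.

Definition lp_sum (r : R) : R := \sum_(x <- E) nu G x * f x `^ r.
Definition lp_moment : R := \sum_(x <- E) nu G x * (f x `^ p * (e x `^ p) ^+ 2).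

(** Only the higher end of an edge is charged, so the power [p - 2], which may be
    negative, is never taken of zero. *)
Definition downhill_energy x y : R :=
  if f y < f x then (f x - f y) ^+ 2 * f x `^ (p - 2) * (e x `^ p) ^+ 2 else 0.
Definition lp_energy : R := \sum_(x <- E) \sum_(y <- E) w x y * downhill_energy x y.

Definition edge_const : R := p ^+ 2 + 2 * p ^+ 2 / (p - 1).

Lemma edge_const_gt0 : 0 < edge_const.
Proof.
have /andP[p1 _] := p12; have p0 : 0 < p by lra.
by rewrite /edge_const addr_gt0 ?exprn_gt0// divr_gt0 ?subr_gt0// mulr_gt0 ?exprn_gt0.
Qed.

Lemma downhill_energy_ge0 x y : 0 <= downhill_energy x y.
Proof.
rewrite /downhill_energy; case: ifP => // _.
by apply: mulr_ge0 (mulr_ge0 (sqr_ge0 _) (powR_ge0 _ _)) (sqr_ge0 _).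
Qed.

Lemma moment_edge_lower x y l : 0 < l ->
  (p - 1) / 2 * (downhill_energy x y + downhill_energy y x)
   - edge_const * ((e x - e y) ^+ 2 * (l `^ (p - 1) * f x `^ p + f x `^ p * (e x `^ p) ^+ 2 / l)
     + (e x - e y) ^+ 2 * (l `^ (p - 1) * f y `^ p + f y `^ p * (e y `^ p) ^+ 2 / l))
  <= (f x - f y) * (f x `^ (p - 1) * (e x `^ p) ^+ 2 - f y `^ (p - 1) * (e y `^ p) ^+ 2).
Proof.
move=> l0; have C0 := ltW edge_const_gt0.
wlog fxy : x y / f y <= f x.
  move=> H; have [|fxy] := leP (f y) (f x); first exact: H.
  have := H y x (ltW fxy).
  by rewrite -[e y - e x]opprB sqrrN; lra.
have pos z : 0 <= l `^ (p - 1) * f z `^ p + f z `^ p * (e z `^ p) ^+ 2 / l.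
  by rewrite addr_ge0 ?mulr_ge0 ?invr_ge0 ?powR_ge0 ?(ltW l0).
have posd z := mulr_ge0 (sqr_ge0 (e x - e y)) (pos z).
move: fxy; rewrite le_eqVlt => /predU1P[fxy|fxy].
  have dx := posd x; have dy := posd y; rewrite fxy in dy.
  rewrite /downhill_energy fxy ltxx addr0 mulr0 subrr mul0r sub0r oppr_le0.
  exact: mulr_ge0 C0 (addr_ge0 dx dy).
have fx0 : 0 < f x by exact: le_lt_trans fxy.
rewrite {2}/downhill_energy ltNge (ltW fxy)/= addr0.
rewrite /downhill_energy fxy.
apply: le_trans (edge_energy_lower (f_ge0 y) (ltW fxy) fx0 (e_ge0 x) (e_ge0 y) p12).
rewrite lerD2l lerN2 -/edge_const; apply: ler_wpM2l => //.
rewrite -mulrDr; apply: ler_wpM2l; first exact: sqr_ge0.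
have /andP[p1 _] := p12.
have /le_trans := @young_powR_split _ (f x) (f y * e y ^+ 2) l p (f_ge0 x)
  (mulr_ge0 (f_ge0 y) (sqr_ge0 _)) l0 p1.
apply; rewrite [X in _ + X / l](_ : _ = f y `^ p * (e y `^ p) ^+ 2); last first.
  by rewrite powRM ?exprn_ge0// expr2 powRM// -expr2.
have h1 : 0 <= f x `^ p * (e x `^ p) ^+ 2 / l.
  by rewrite !mulr_ge0 ?invr_ge0 ?powR_ge0 ?(ltW l0).
have h2 : 0 <= l `^ (p - 1) * f y `^ p by rewrite mulr_ge0 ?powR_ge0.
lra.
Qed.

(** A Caccioppoli inequality: the Dirichlet form that governs the decay of
    [lp_moment] dominates the energy far from the base point, up to terms of lower
    order in the distance.  The parameter [l] will be a multiple of the elapsed time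
    in units of [1 / b]. *)
Lemma moment_dissipation l : 0 < l ->
  (p - 1) * lp_energy - 2 * edge_const * b * (l `^ (p - 1) * lp_sum p + lp_moment / l)
  <= dform G E f (fun x => f x `^ (p - 1) * (e x `^ p) ^+ 2).
Proof.
move=> l0; have C0 := ltW edge_const_gt0.
pose h z := l `^ (p - 1) * f z `^ p + f z `^ p * (e z `^ p) ^+ 2 / l.
have h0 z : 0 <= h z.
  by rewrite addr_ge0 ?mulr_ge0 ?invr_ge0 ?powR_ge0 ?(ltW l0).
have hE : \sum_(x <- E) nu G x * h x = l `^ (p - 1) * lp_sum p + lp_moment / l.
  rewrite /lp_sum /lp_moment mulr_sumr mulr_suml -big_split/=.
  by apply: eq_bigr => x _; rewrite /h; ring.
have S1 := adapted_sum_out h0; have S2 := adapted_sum_in h0; rewrite hE in S1 S2.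
apply: (@le_trans _ _ ((p - 1) / 2 * (lp_energy + lp_energy) - edge_const *
   (\sum_(x <- E) \sum_(y <- E) w x y * ((e x - e y) ^+ 2 * h x) +
    \sum_(x <- E) \sum_(y <- E) w x y * ((e x - e y) ^+ 2 * h y)))).
  have := ler_wpM2l C0 (lerD S1 S2); lra.
rewrite {2}/lp_energy exchange_big/= /lp_energy -!big_split/= !mulr_sumr -sumrB.
apply: ler_sum => x _; rewrite -!big_split/= !mulr_sumr -sumrB; apply: ler_sum => y _.
have := ler_wpM2l (w_ge0 x y) (moment_edge_lower x y l0).
rewrite (edge_weight_sym G y x) -/(h x) -/(h y); lra.
Qed.

Definition cutoff (s : R) : R := Num.max 0 (Num.min 1 (2 - 2 * s)).

Lemma cutoff_ge0 s : 0 <= cutoff s.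
Proof. by rewrite /cutoff le_max lexx. Qed.

Lemma cutoff_le1 s : cutoff s <= 1.
Proof. by rewrite /cutoff ge_max ler01 ge_min lexx. Qed.

Lemma cutoff_out s : 1 <= s -> cutoff s = 0.
Proof. by move=> s1; rewrite /cutoff max_l// ge_min; apply/orP; right; lra. Qed.

Lemma cutoff0 : cutoff 0 = 1.
Proof. by rewrite /cutoff mulr0 subr0 min_l ?max_r// ler1n. Qed.

Lemma cutoff_drop s r : cutoff r < cutoff s ->
  [/\ s < 1, 2^-1 < r, s < r & cutoff s - cutoff r <= 2 * (r - s)].
Proof.
move=> h; have s1 : s < 1 by rewrite ltNge; apply/negP => /cutoff_out sE; move: h;
  rewrite sE ltNge cutoff_ge0.
have r2 : 2^-1 < r.
  rewrite ltNge; apply/negP => r2; move: h; rewrite ltNge => /negP; apply.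
  apply: le_trans (cutoff_le1 s) _; rewrite /cutoff le_max; apply/orP; right.
  by rewrite le_min lexx/=; lra.
have key : cutoff s - cutoff r <= 2 * (r - s).
  have cr : 2 - 2 * r <= cutoff r.
    rewrite /cutoff le_max; apply/orP; right; rewrite le_min lexx andbT; lra.
  have cs : cutoff s <= 2 - 2 * s.
    by rewrite /cutoff ge_max ge_min lexx orbT andbT; lra.
  lra.
by split=> //; lra.
Qed.

Variable W : R.
Hypothesis W_gt0 : 0 < W.
Hypothesis W_ball : \sum_(x <- E) (if e x <= 1 then nu G x else 0) <= W.
Hypothesis f_mass : \sum_(x <- E) nu G x * f x <= 1.

(** An energy term, a term for the long jumps out of the ball of radius [1 / 4],
    and the volume term that the arithmetic-geometric mean inequality pairs with
    the energy. *)
Definition flux_bound (eta : R) x y : R :=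
  eta * downhill_energy x y + (16 * ((e x - e y) ^+ 2 * f x) +
    256 / eta * ((e x - e y) ^+ 2 * (if e x <= 1 then f x `^ (2 - p) else 0))).

Lemma flux_bound_ge0 eta x y : 0 < eta -> 0 <= flux_bound eta x y.
Proof.
move=> eta0; have eta0' := ltW eta0.
have h1 := mulr_ge0 eta0' (downhill_energy_ge0 x y).
have h2 := mulr_ge0 (sqr_ge0 (e x - e y)) (f_ge0 x).
have h3 : 0 <= 256 / eta * ((e x - e y) ^+ 2 * (if e x <= 1 then f x `^ (2 - p) else 0)).
  apply: mulr_ge0; first exact: divr_ge0 (ler0n _ _) eta0'.
  by apply: mulr_ge0 (sqr_ge0 _) _; case: ifP => // _; exact: powR_ge0.
by rewrite /flux_bound; lra.
Qed.

(** Mass crosses the cutoff only along edges on which both the solution and the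
    cutoff go down.  If such an edge starts within distance [1 / 4] it has length at
    least [1 / 4], and [16 (e x - e y)^2 >= 1] charges it to adaptedness.
    Otherwise [e x >= 1 / 4] and the energy weight is bounded below there, so
    the arithmetic-geometric mean inequality applies. *)
Lemma flux_edge_upper_downhill eta x y : 0 < eta -> f y < f x ->
  cutoff (e y) < cutoff (e x) ->
  (f x - f y) * (cutoff (e x) - cutoff (e y)) <= flux_bound eta x y.
Proof.
move=> eta0 fxy /cutoff_drop[ex1 ey2 exy cc]; have /andP[p1 p2] := p12.
have fy0 := f_ge0 y; have fx0 : 0 < f x by exact: le_lt_trans fxy.
have D0 := mulr_ge0 (ltW eta0) (downhill_energy_ge0 x y).
have T0 : 0 <= 256 / eta * ((e x - e y) ^+ 2 * f x `^ (2 - p)).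
  apply: mulr_ge0; first exact: divr_ge0 (ler0n _ _) (ltW eta0).
  exact: mulr_ge0 (sqr_ge0 _) (powR_ge0 _ _).
rewrite /flux_bound (ltW ex1).
have [near_o|far] := leP (4^-1) (e x); last first.
  have c1 : cutoff (e x) - cutoff (e y) <= 1.
    by have := cutoff_le1 (e x); have := cutoff_ge0 (e y); lra.
  have d1 : 1 <= 16 * (e x - e y) ^+ 2.
    rewrite -[e x - e y]opprB sqrrN (_ : 16 = 4 ^+ 2); last by rewrite -natrX.
    by rewrite -exprMn exprn_ege1//; lra.
  have h1 : (f x - f y) * (cutoff (e x) - cutoff (e y)) <= (f x - f y) * 1.
    by rewrite ler_wpM2l// subr_ge0 ltW.
  have h2 := ler_wpM2r (ltW fx0) d1.
  lra.
have S0 : 0 <= 16 * ((e x - e y) ^+ 2 * f x).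
  by apply: mulr_ge0 => //; exact: mulr_ge0 (sqr_ge0 _) (ltW fx0).
have h1 : (f x - f y) * (cutoff (e x) - cutoff (e y)) <= (f x - f y) * (2 * (e y - e x)).
  by rewrite ler_wpM2l// subr_ge0 ltW.
suff h2 : (f x - f y) * (2 * (e y - e x)) <=
    eta * downhill_energy x y + 256 / eta * ((e x - e y) ^+ 2 * f x `^ (2 - p)) by lra.
rewrite /downhill_energy fxy.
have X0 : 16^-1 <= e x `^ p.
  apply: (@le_trans _ _ (4^-1 `^ 2)).
    by rewrite powR_mulrn ?invr_ge0// exprVn -natrX lexx.
  apply: (@le_trans _ _ (4^-1 `^ p)); first by rewrite ger_powR//; apply/andP; split; lra.
  by apply: ge0_ler_powR; rewrite ?nnegrE//; lra.
have -> : f x `^ (2 - p) = (f x `^ (p - 2))^-1.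
  by rewrite -powRN; congr (_ `^ _); ring.
have c0 : 0 < f x `^ (p - 2) by rewrite powR_gt0.
move: (f x `^ (p - 2)) (e x `^ p) c0 X0 => c X c0 X0.
have Xp : 0 < X by apply: lt_le_trans X0; rewrite invr_gt0.
(* 256 = 16^2 bounds 1 / X^2 because X = (e x)^p >= (1/4)^2 *)
have X256 : (X ^+ 2)^-1 <= 256.
  have h16 : 1 <= 16 * X by rewrite -ler_pdivrMl// mulr1.
  rewrite -[leLHS]mul1r ler_pdivrMr ?exprn_gt0//.
  rewrite (_ : 256 * X ^+ 2 = (16 * X) ^+ 2); last by ring.
  exact: exprn_ege1.
have d0 : 0 <= (e x - e y) ^+ 2 / (c * eta).
  by rewrite divr_ge0 ?sqr_ge0// mulr_ge0// ltW.
have h3 := ler_wpM2l d0 X256.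
have h4 : (f x - f y) * (2 * (e y - e x)) <=
   eta * ((f x - f y) ^+ 2 * c * X ^+ 2) + (e x - e y) ^+ 2 / (c * eta) * (X ^+ 2)^-1.
  rewrite -subr_ge0 [leRHS](_ : _ = (eta * c) *
    ((f x - f y) * X - (e y - e x) / (eta * c * X)) ^+ 2).
    by apply: mulr_ge0 (sqr_ge0 _); rewrite mulr_ge0// ltW.
  by field; rewrite !gt_eqF.
apply: le_trans h4 _; rewrite lerD2l; apply: le_trans h3 _.
by rewrite le_eqVlt; apply/orP; left; apply/eqP; field; rewrite !gt_eqF.
Qed.

Lemma flux_edge_upper eta x y : 0 < eta ->
  (f x - f y) * (cutoff (e x) - cutoff (e y)) <= flux_bound eta x y + flux_bound eta y x.
Proof.
move=> eta0; have h1 := flux_bound_ge0 x y eta0; have h2 := flux_bound_ge0 y x eta0.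
have [fxy|fxy|fxy] := ltgtP (f x) (f y); last by rewrite fxy subrr mul0r addr_ge0.
- have [cc|cc] := ltP (cutoff (e x)) (cutoff (e y)).
    have := flux_edge_upper_downhill eta0 fxy cc; lra.
  apply: le_trans (_ : 0 <= _); last by rewrite addr_ge0.
  by rewrite mulr_le0_ge0// ?subr_le0 ?subr_ge0// ltW.
- have [cc|cc] := ltP (cutoff (e y)) (cutoff (e x)).
    have := flux_edge_upper_downhill eta0 fxy cc; lra.
  apply: le_trans (_ : 0 <= _); last by rewrite addr_ge0.
  by rewrite mulr_ge0_le0// ?subr_le0 ?subr_ge0// ltW.
Qed.

(** The truncation at height [1 / W] replaces the Hoelder inequality. *)
Lemma ball_compl_sum : \sum_(x <- E) nu G x * (if e x <= 1 then f x `^ (2 - p) else 0)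
  <= 2 * W `^ (p - 1).
Proof.
have W0 := ltW W_gt0; have /andP[p1 p2] := p12.
apply: (@le_trans _ _ (\sum_(x <- E) (if e x <= 1 then nu G x else 0) * W `^ (p - 2) +
    \sum_(x <- E) nu G x * f x * W `^ (p - 1))).
  rewrite -big_split/=; apply: ler_sum => x _.
  have h : 0 <= nu G x * f x * W `^ (p - 1) by exact: mulr_ge0 (mulr_ge0 (nu_ge0 x) (f_ge0 x)) (powR_ge0 _ _).
  case: ifP => _; last by rewrite mulr0 mul0r add0r.
  by rewrite -mulrA -mulrDr ler_wpM2l ?nu_ge0// powR_compl_le.
rewrite -!mulr_suml.
have -> : 2 * W `^ (p - 1) = W * W `^ (p - 2) + 1 * W `^ (p - 1).
  rewrite mul1r -{2}(powRr1 W0) -powRD ?(gt_eqF W_gt0) ?implybT//.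
  by rewrite (_ : 1 + (p - 2) = p - 1); [rewrite mulr_natl mulr2n|ring].
by rewrite lerD// ler_wpM2r// powR_ge0.
Qed.

(** The mass lost by the ball per unit time, for any trade-off [eta] between
    energy and volume. *)
Lemma mass_flux eta : 0 < eta -> 0 <= b ->
  2^-1 * dform G E f (fun x => cutoff (e x)) <=
  eta * lp_energy + b * (16 + 512 / eta * W `^ (p - 1)).
Proof.
move=> eta0 b0.
pose h1 := adapted_sum_out f_ge0.
have g0 x : 0 <= (if e x <= 1 then f x `^ (2 - p) else 0).
  by case: ifP => // _; exact: powR_ge0.
have h2 := adapted_sum_out g0.
pose S := \sum_(x <- E) \sum_(y <- E) w x y * flux_bound eta x y.
have dS : dform G E f (fun x => cutoff (e x)) <= S + S.
  rewrite {2}/S exchange_big/= /S -big_split/=; apply: ler_sum => x _.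
  rewrite -big_split/=; apply: ler_sum => y _.
  rewrite (edge_weight_sym G y x) -mulrDr; apply: ler_wpM2l (flux_edge_upper x y eta0).
  exact: w_ge0.
have SE : S = eta * lp_energy +
   (16 * \sum_(x <- E) \sum_(y <- E) w x y * ((e x - e y) ^+ 2 * f x) +
    256 / eta * \sum_(x <- E) \sum_(y <- E) w x y * ((e x - e y) ^+ 2 *
      (if e x <= 1 then f x `^ (2 - p) else 0))).
  rewrite /S /lp_energy !mulr_sumr -!big_split/=; apply: eq_bigr => x _.
  rewrite !mulr_sumr -!big_split/=; apply: eq_bigr => y _.
  by rewrite /flux_bound; move: (256 / eta) (if _ then _ else _) => k v; ring.
have h3 := ler_wpM2l b0 f_mass; have h4 := ler_wpM2l b0 ball_compl_sum.
have h5 : 0 <= 256 / eta by rewrite divr_ge0// ltW.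
have h6 := ler_wpM2l h5 (le_trans h2 h4).
have h7 := le_trans h1 h3.
have -> : 512 / eta = 2 * (256 / eta) by rewrite mulrA -natrM.
move: h5 h6 SE; move: (256 / eta) => k h5 h6 SE; lra.
Qed.

Variable q : R.
Hypothesis pq : p <= q.

Lemma lp_sum_le_lq : W `^ (p - 1) * lp_sum p <= 1 + W `^ (q - 1) * lp_sum q.
Proof.
have /andP[p1 p2] := p12.
have : lp_sum p <= W `^ (1 - p) * 1 + W `^ (q - p) * lp_sum q.
  apply: (@le_trans _ _ (W `^ (1 - p) * \sum_(x <- E) nu G x * f x + W `^ (q - p) * lp_sum q)).
    rewrite /lp_sum !mulr_sumr -big_split/=; apply: ler_sum => x _.
    have := ler_wpM2l (nu_ge0 x) (powR_le_truncation (f_ge0 x) W_gt0 p1 pq); lra.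
  by rewrite lerD2r ler_wpM2l// powR_ge0.
move=> /(ler_wpM2l (powR_ge0 W (p - 1))) /le_trans; apply.
rewrite mulrDr mulr1 mulrA -!powRD ?(gt_eqF W_gt0) ?implybT//.
rewrite (_ : p - 1 + (1 - p) = 0); last by ring.
by rewrite powRr0 (_ : p - 1 + (q - p) = q - 1)//; ring.
Qed.

Lemma local_mass_le : \sum_(x <- E) nu G x * cutoff (e x) * f x <=
  4^-1 + (4 * W) `^ (q - 1) * lp_sum q.
Proof.
have /andP[p1 p2] := p12; have q1 : 1 < q by exact: lt_le_trans pq.
apply: (@le_trans _ _ ((4 * W)^-1 * W + (4 * W) `^ (q - 1) * lp_sum q)); last first.
  by rewrite invfM mulfVK ?gt_eqF.
apply: (@le_trans _ _ ((4 * W)^-1 * (\sum_(x <- E) (if e x <= 1 then nu G x else 0)) +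
   (4 * W) `^ (q - 1) * lp_sum q)); last first.
  by rewrite lerD2r ler_wpM2l// invr_ge0 mulr_ge0// ltW.
rewrite /lp_sum !mulr_sumr -big_split/=; apply: ler_sum => x _.
have h := le_quarter_truncation (f_ge0 x) W_gt0 q1.
have h0 : 0 <= (4 * W) `^ (q - 1) * f x `^ q by rewrite mulr_ge0 ?powR_ge0.
have h0' := mulr_ge0 (nu_ge0 x) h0.
case: ifPn => [_|]; last first.
  by rewrite -ltNge => /ltW /cutoff_out ->; rewrite mulr0 mul0r mulr0; lra.
have h1 := ler_wpM2r (f_ge0 x) (ler_wpM2l (nu_ge0 x) (cutoff_le1 (e x))).
have h2 := ler_wpM2l (nu_ge0 x) h.
lra.
Qed.

End FixedTime.

(** * The Lyapunov functional along the heat flow *)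

Section PowerContinuity.
Context {R : realType}.

(** The absolute value makes the power continuous on the whole line, so that
    no one-sided argument is needed at 0. *)
Lemma continuous_norm_powR (k : R) : 0 < k -> continuous (fun x : R => `|x| `^ k).
Proof.
move=> k0 x; have [->|x0] := eqVneq x 0; last first.
  apply: (@continuous_comp _ _ _ (fun y : R => `|y|) (fun y => y `^ k)).
    exact: norm_continuous.
  apply: (is_derive_continuous (df := k * `|x| `^ (k - 1))).
  by apply: is_derive1_powR; rewrite normr_gt0.
apply/cvgrPdist_le => eps eps0; rewrite normr0 powR0 ?gt_eqF//.
have d0 : 0 < eps `^ k^-1 by rewrite powR_gt0.
near=> y; rewrite sub0r normrN ger0_norm ?powR_ge0//.
have : `|y| <= eps `^ k^-1.
  near: y; apply/nbhs_ballP; exists (eps `^ k^-1) => //= z.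
  by rewrite /ball/= sub0r normrN => /ltW.
move=> /(@ge0_ler_powR _ k (ltW k0) _ _ _ _); rewrite !nnegrE normr_ge0 powR_ge0.
by move=> /(_ isT isT); rewrite -powRrM mulVf ?gt_eqF// powRr1// ltW.
Unshelve. all: by end_near. Qed.

Lemma within_continuous_right (f : R -> R) (T : R) : 0 < T ->
  (forall t, 0 < t -> {for t, continuous f}) -> f t @[t --> 0^'+] --> f 0 ->
  {within `[0, T], continuous f}.
Proof.
move=> T0 cf f0; apply/continuous_within_itvP => //; split => //.
  by move=> t; rewrite in_itv/= => /andP[t0 _]; exact: cf.
exact/cvg_at_left_filter/cf.
Qed.

End PowerContinuity.

Section Constants.
Context {R : realType}.
Implicit Types p q : R.

(** The coefficient of the [L^p] norm that remains when [l] in the Caccioppoli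
    inequality is chosen to cancel the derivative of the time weight
    [tau `^ (- (p - 1) / 2)]. *)
Definition flux_const p : R :=
  p * edge_const p * (p * edge_const p / ((p - 1) / 2)) `^ (p - 1).

(** The rate, in units of [b], at which the Lyapunov functional may decrease for
    lack of anything better than the total mass. *)
Definition loss_const p : R := 16 + 512 / (p * (p - 1) / 2) + flux_const p.

(** Over this time, in units of [1 / b], that loss amounts to a quarter of the
    mass. *)
Definition time_const p : R := (4 * loss_const p)^-1.

(** The integral of [s `^ ((p - 1) / 2)] over [[0, time_const p]]. *)
Definition window_const p : R :=
  time_const p `^ ((p - 1) / 2 + 1) / ((p - 1) / 2 + 1).

(** The solution [X] of [4 `^ (q - 1) * X = (1 / 2 - flux_const p * X) * v], where
    [v] is [window_const p]. *)
Definition scale_const p q : R :=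
  (window_const p / 2) / (4 `^ (q - 1) + flux_const p * window_const p).

Lemma flux_const_gt0 p : 1 < p <= 2 -> 0 < flux_const p.
Proof.
move=> p12; have C0 := edge_const_gt0 p12; have /andP[p1 p2] := p12.
have p0 : 0 < p by lra.
by rewrite /flux_const mulr_gt0 ?powR_gt0 ?divr_gt0 ?mulr_gt0 ?subr_gt0.
Qed.

Lemma loss_const_ge1 p : 1 < p <= 2 -> 1 <= loss_const p.
Proof.
move=> p12; have C0 := flux_const_gt0 p12; have /andP[p1 p2] := p12.
have h : 0 <= 512 / (p * (p - 1) / 2).
  by apply: divr_ge0 (ler0n _ _) _; rewrite divr_ge0// mulr_ge0//; lra.
rewrite /loss_const; lra.
Qed.

Lemma time_const_gt0 p : 1 < p <= 2 -> 0 < time_const p.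
Proof.
by move=> /loss_const_ge1 h; rewrite /time_const invr_gt0 mulr_gt0// (lt_le_trans _ h).
Qed.

Lemma time_const_le1 p : 1 < p <= 2 -> time_const p <= 1.
Proof.
move=> /loss_const_ge1; rewrite /time_const; move: (loss_const p) => l l1.
have l0 : 0 < 4 * l by lra.
by rewrite invf_le1//; lra.
Qed.

Lemma window_const_gt0 p : 1 < p <= 2 -> 0 < window_const p.
Proof.
move=> p12; have t0 := time_const_gt0 p12; have /andP[p1 p2] := p12.
by apply: divr_gt0; [exact: powR_gt0|lra].
Qed.

Lemma scale_const_gt0 p q : 1 < p <= 2 -> 0 < scale_const p q.
Proof.
move=> p12; have C0 := flux_const_gt0 p12; have v0 := window_const_gt0 p12.
apply: divr_gt0; first by rewrite divr_gt0.
by rewrite addr_gt0 ?powR_gt0// mulr_gt0.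
Qed.

End Constants.

(** The bookkeeping behind the Lyapunov functional, with [P], [B], [tau] for
    [W `^ (p - 1)], [tau `^ k], [b * t].  The weight [P / B] on the moment is such that
    the energy [Q] produced by the moment pays exactly for the energy spent by the
    flux, and [lam = p * C / k] cancels the moment [Z]. *)
Lemma lyapunov_algebra (R : realType) (p C k lam Lm b P B tau Q F S Z Fp Fq Wq : R) :
  1 < p -> 0 < C -> 0 < k -> 0 < lam -> 0 <= Lm -> 0 < b -> 0 < P -> 0 < B -> B <= 1 -> 0 < tau ->
  lam = p * C / k ->
  2^-1 * F <= P * B^-1 * (p * (p - 1) / 2) * Q +
     b * (16 + 512 / (P * B^-1 * (p * (p - 1) / 2)) * P) ->
  (p - 1) * Q - 2 * C * b * (Lm * B ^+ 2 * Fp + Z / (lam * tau)) <= S ->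
  P * Fp <= 1 + Wq * Fq ->
  - (b * (16 + 512 / (p * (p - 1) / 2) + p * C * Lm)) - p * C * Lm * b * Wq * (B * Fq) <=
  - (2^-1 * F) - P * (B^-1 * (p * - (2^-1 * S)) + Z * (- k * (B^-1 / tau) * b)).
Proof.
move=> p1 C0 k0 lam0 Lm0 b0 P0 B0 B1 tau0 lamE H1 H2 H3.
have p0 : 0 < p by lra.
have d0 : 0 < p - 1 by lra.
have K0 : 0 <= P * B^-1 * (p / 2).
  by rewrite !mulr_ge0 ?divr_ge0 ?invr_ge0 ?(ltW P0) ?(ltW B0) ?(ltW p0).
have c00 : 0 < p * (p - 1) / 2 by rewrite divr_gt0// mulr_gt0.
have N0 : 0 <= p * C * Lm * b by rewrite !mulr_ge0// ltW.
have K2 := ler_wpM2l K0 H2; have K3 := ler_wpM2l (mulr_ge0 N0 (ltW B0)) H3.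
have K4 := ler_wpM2l N0 B1.
have K5 : 512 / (p * (p - 1) / 2) * b * B <= 512 / (p * (p - 1) / 2) * b.
  rewrite -[leRHS]mulr1; apply: ler_wpM2l B1.
  exact: mulr_ge0 (divr_ge0 (ler0n _ _) (ltW c00)) (ltW b0).
have e2 : 512 / (P * B^-1 * (p * (p - 1) / 2)) * P = 512 / (p * (p - 1) / 2) * B.
  by field; rewrite !gt_eqF.
rewrite e2 in H1.
have e3 : P * B^-1 * (p / 2) * ((p - 1) * Q - 2 * C * b * (Lm * B ^+ 2 * Fp + Z / (lam * tau))) =
   P * B^-1 * (p * (p - 1) / 2) * Q - p * C * Lm * b * B * (P * Fp) - P * (k * (B^-1 / tau) * b) * Z.
  by rewrite lamE; field; rewrite !gt_eqF.
rewrite e3 in K2; move: H1 K2 K3 K4 K5 {e2 e3}.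
have -> : P * B^-1 * (p / 2) * S = P * (B^-1 * (p * (2^-1 * S))) by ring.
move: (p * (p - 1) / 2) => c1; move: (512 / c1) B^-1 tau^-1 => c0 A T.
lra.
Qed.

Section Evolution.
Context {R : realType} {V : choiceType} (G : wgraph R V).
Variables (D : set V) (Dfin : finite_set D) (Dcon : connected_in (adj G) D).
Variables (o : V) (Do : D o).
Local Notation E := (closed_nbhd G D).
Local Notation u t := (dirichlet_heat_kernel G D t o).
Variables (e : V -> R) (b W p q : R).
Hypothesis e_ge0 : forall x, 0 <= e x.
Hypothesis e_o : e o = 0.
Hypothesis e_ball : forall x, e x <= 1 -> D x.
Hypothesis b_gt0 : 0 < b.
Hypothesis e_adapted : forall x,
  \sum_(y <- E) edge_weight G x y * (e x - e y) ^+ 2 <= b * nu G x.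
Hypothesis W_gt0 : 0 < W.
Hypothesis W_ball : \sum_(x <- E) (if e x <= 1 then nu G x else 0) <= W.
Hypothesis p12 : 1 < p <= 2.
Hypothesis pq : p <= q.

Let kap : R := (p - 1) / 2.
Let p1 : 1 < p. Proof. by case/andP: p12. Qed.
Let p0 : 0 < p. Proof. exact: lt_trans p1. Qed.
Let q0 : 0 < q. Proof. exact: lt_le_trans pq. Qed.
Let kap_gt0 : 0 < kap. Proof. by rewrite /kap divr_gt0// subr_gt0. Qed.

Let Z (t : R) := lp_moment G E e (u t) p.
Let M (t : R) := \sum_(x <- E) nu G x * cutoff (e x) * u t x.
Let F (t : R) := lp_sum G E (u t) q.

Lemma is_derive_moment (t : R) : 0 < t -> is_derive t 1 Z
  (p * - (2^-1 * dform G E (u t) (fun x => u t x `^ (p - 1) * (e x `^ p) ^+ 2))).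
Proof.
move=> t0; rewrite -green_formula//; last first.
  by move=> x Dx; rewrite heat_out// powR0 ?mul0r// gt_eqF// subr_gt0.
rewrite mulr_sumr; apply: is_derive_sum_seq => x _.
have [Dx|Dx] := pselect (D x); last first.
  under eq_fun do rewrite (heat_out _ _ _ _ Dx)// powR0 ?gt_eqF// mul0r mulr0.
  rewrite (heat_out _ _ _ _ Dx)// powR0 ?gt_eqF ?subr_gt0// mul0r mulr0 mul0r mulr0.
  exact: is_derive_cst.
have h := is_derive_powR_comp p (is_derive_heat G Dfin Do t Dx) (heat_gt0 Dfin Do Dcon t0 Dx).
under eq_fun do rewrite mulrA mulrAC.
by apply: (is_derive_eq (is_deriveZ (nu G x * (e x `^ p) ^+ 2) h)); rewrite /GRing.scale/=; ring.
Qed.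

Lemma is_derive_mass (t : R) : is_derive t 1 M
  (- (2^-1 * dform G E (u t) (fun x => cutoff (e x)))).
Proof.
have c_out x : ~ D x -> cutoff (e x) = 0.
  move=> Dx; apply: cutoff_out; rewrite leNgt; apply/negP => ex; apply: Dx.
  exact/e_ball/ltW.
rewrite -green_formula//; apply: is_derive_sum_seq => x _.
have [Dx|Dx] := pselect (D x); last first.
  under eq_fun do rewrite (c_out _ Dx) mulr0 mul0r.
  by rewrite (c_out _ Dx) mulr0 mul0r; exact: is_derive_cst.
exact: (is_deriveZ _ (is_derive_heat G Dfin Do t Dx)).
Qed.

Let Phi (t : R) := M t - W `^ (p - 1) * ((b * t) `^ (- kap) * Z t).

(** [M] decreases by the flux through the cutoff, which is controlled by the
    energy; the moment [Z] decreases by the same energy.  Subtracting [Z] with the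
    singular weight [(b t) `^ (- kap)] therefore removes the energy, and the
    error contains the factor [(b t) `^ kap] that makes the final sum
    over scales converge. *)
Lemma lyapunov_derivative (t : R) : 0 < t -> b * t <= 1 ->
  exists2 dPhi : R, is_derive t 1 Phi dPhi &
    - (b * loss_const p) - flux_const p * b * W `^ (q - 1) * ((b * t) `^ kap * F t) <= dPhi.
Proof.
move=> t0 bt1; have bt0 : 0 < b * t by rewrite mulr_gt0.
have dbt : is_derive t 1 (fun s : R => b * s) b.
  by apply: is_derive_eq; rewrite /GRing.scale/= mulr1.
have dpow := is_derive_powR_comp (- kap) dbt bt0.
exists (- (2^-1 * dform G E (u t) (fun x => cutoff (e x))) - W `^ (p - 1) *
  ((b * t) `^ (- kap) * (p * - (2^-1 * dform G E (u t) (fun x => u t x `^ (p - 1) * (e x `^ p) ^+ 2)))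
   + Z t * (- kap * (b * t) `^ (- kap - 1) * b))).
  exact: (is_deriveB (is_derive_mass t) (is_deriveZ _ (is_deriveM dpow (is_derive_moment t0)))).
have u0 x : 0 <= u t x by exact: heat_ge0 (ltW t0).
have mass := heat_mass_le1 G Dfin Do (ltW t0).
have C0 := edge_const_gt0 p12.
pose lam := p * edge_const p / kap; have lam0 : 0 < lam by rewrite divr_gt0// mulr_gt0.
pose B := (b * t) `^ kap; have B0 : 0 < B by rewrite powR_gt0.
have B1 : B <= 1.
  have : (b * t) `^ kap <= 1 `^ kap by rewrite ge0_ler_powR ?nnegrE// ltW.
  by rewrite powR1.
have AE : (b * t) `^ (- kap) = B^-1 by rewrite powRN.
have A1E : (b * t) `^ (- kap - 1) = B^-1 / (b * t).
  by rewrite powRB ?(gt_eqF bt0) ?implybT// AE powRr1// ltW.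
have lE : (lam * (b * t)) `^ (p - 1) = lam `^ (p - 1) * B ^+ 2.
  rewrite powRM ?(ltW lam0) ?(ltW bt0)// expr2 -powRD ?(gt_eqF bt0) ?implybT//.
  by congr (_ * _ `^ _); rewrite /kap; field.
rewrite AE A1E -/B.
have P0 : 0 < W `^ (p - 1) by rewrite powR_gt0.
have c00 : 0 < p * (p - 1) / 2 by rewrite divr_gt0// mulr_gt0// subr_gt0.
have eta0 : 0 < W `^ (p - 1) * B^-1 * (p * (p - 1) / 2).
  by apply: mulr_gt0 c00; rewrite mulr_gt0// invr_gt0.
have H1 := mass_flux e_ge0 e_adapted u0 p12 W_gt0 W_ball mass eta0 (ltW b_gt0).
have H2 := moment_dissipation e_ge0 e_adapted u0 p12 (mulr_gt0 lam0 bt0).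
have H3 := lp_sum_le_lq u0 p12 W_gt0 mass pq.
rewrite lE in H2.
exact: (lyapunov_algebra p1 C0 kap_gt0 lam0 (powR_ge0 _ _) b_gt0 P0 B0 B1 bt0 erefl H1 H2 H3).
Qed.

(** Away from [o] the solution starts from 0 with bounded derivative; this tames
    the singular weight at time 0. *)
Lemma heat_linear_near0 x : x != o ->
  exists2 K : R, 0 <= K & forall t : R, 0 < t -> u t x <= K * t.
Proof.
move=> xo; have [Dx|Dx] := pselect (D x); last first.
  by exists 0 => // t t0; rewrite heat_out// mul0r.
pose K := (nu G x)^-1 * \sum_(y <- E) edge_weight G x y * (nu G y)^-1.
have K0 : 0 <= K.
  rewrite mulr_ge0 ?invr_ge0 ?(ltW (nu_gt0 _ _))// sumr_ge0// => y _.
  by rewrite mulr_ge0 ?edge_weight_ge0// invr_ge0 ltW// nu_gt0.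
have [c c0 cP] := heat_growth G Dfin Do Dx.
exists K => // t t0; have [s /andP[s0 st] uE] := cP t t0.
rewrite heat0// (negbTE xo) add0r in uE.
rewrite -(@ler_pM2l _ (expR (c * t))) ?expR_gt0// uE.
rewrite (_ : expR (c * t) * (K * t) = t * (expR (c * t) * K)); last by ring.
apply: ler_wpM2l; first exact: ltW.
apply: ler_pM.
- exact: expR_ge0.
- rewrite mulr_ge0 ?invr_ge0 ?(ltW (nu_gt0 _ _))// sumr_ge0// => y _.
  by rewrite mulr_ge0 ?edge_weight_ge0// heat_ge0// ltW.
- by rewrite ler_expR ler_wpM2l// ltW.
- apply: ler_wpM2l; first by rewrite invr_ge0 ltW ?nu_gt0.
  apply: ler_sum => y _; apply: ler_wpM2l; first exact: edge_weight_ge0.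
  exact: heat_le_inv_nu (ltW s0).
Qed.

(** The moment is of order [t `^ p], since its weight vanishes at [o], and
    [kap < p]. *)
Lemma weighted_moment_cvg0 : (b * t) `^ (- kap) * Z t @[t --> 0^'+] --> (0 : R).
Proof.
have -> : (fun t => (b * t) `^ (- kap) * Z t) = (fun t => \sum_(x <- E)
    (b * t) `^ (- kap) * (nu G x * (u t x `^ p * (e x `^ p) ^+ 2))).
  by apply/funext => t; rewrite mulr_sumr.
have -> : (nbhs (0 : R)) = nbhs (\sum_(x <- E) (0 : R)) by rewrite big1.
apply: cvg_sum_seq => x _; have [->|xo] := eqVneq x o.
  have -> : (fun t : R => (b * t) `^ (- kap) * (nu G o * (u t o `^ p * (e o `^ p) ^+ 2))) = cst 0.
    by apply/funext => t; rewrite e_o powR0 ?gt_eqF// expr0n/= !mulr0.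
  exact: cvg_cst.
have [K K0 uK] := heat_linear_near0 xo.
pose c := b `^ (- kap) * (nu G x * (K `^ p * (e x `^ p) ^+ 2)).
apply: (@squeeze_cvgr _ _ _ _ (cst 0) (fun t : R => c * t `^ (p - kap))).
- near=> t; have t0 : 0 < t by near: t; exact: nbhs_right_gt.
  have u0 : 0 <= u t x by exact: heat_ge0 (ltW t0).
  have term_ge0 : 0 <= nu G x * (u t x `^ p * (e x `^ p) ^+ 2).
    exact: mulr_ge0 (ltW (nu_gt0 _ _)) (mulr_ge0 (powR_ge0 _ _) (sqr_ge0 _)).
  rewrite /= (mulr_ge0 (powR_ge0 _ _) term_ge0)/=.
  have uKt : u t x `^ p <= K `^ p * t `^ p.
    rewrite -powRM ?(ltW t0)//; apply: ge0_ler_powR; rewrite ?nnegrE ?(ltW p0)//.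
      by rewrite mulr_ge0// ltW.
    exact: uK.
  rewrite powRB ?(gt_eqF t0) ?implybT// -powRN powRM ?(ltW b_gt0) ?(ltW t0)//.
  rewrite /c [leRHS](_ : _ = (b `^ (- kap) * t `^ (- kap)) *
      (nu G x * ((K `^ p * t `^ p) * (e x `^ p) ^+ 2))); last by ring.
  apply: ler_wpM2l; first by rewrite mulr_ge0 ?powR_ge0.
  apply: ler_wpM2l; first exact: ltW (nu_gt0 _ _).
  by apply: ler_wpM2r; rewrite ?sqr_ge0.
- exact: cvg_cst.
- rewrite -[X in _ --> X](mulr0 c); apply: cvgMl_tmp; apply: powR_cvg0.
  by rewrite /kap; move: p1 p12; lra.
Unshelve. all: by end_near. Qed.

Lemma lyapunov_at0 : Phi 0 = 1.
Proof.
rewrite /Phi mulr0 powR0 ?oppr_eq0 ?gt_eqF// mul0r mulr0 subr0 /M.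
rewrite (big_fsetD1 o)/=; last exact: mem_closed_nbhd.
rewrite heat0// eqxx e_o cutoff0 mulr1 mulfV ?gt_eqF ?nu_gt0//.
rewrite big_seq big1 ?addr0// => x; rewrite !inE => /andP[xo _].
by rewrite heat0// (negbTE xo) mulr0.
Qed.

Let T : R := time_const p / b.
Let T_gt0 : 0 < T. Proof. by rewrite divr_gt0// time_const_gt0. Qed.

Let bT t : t <= T -> b * t <= 1.
Proof.
move=> tT; apply: (@le_trans _ _ (time_const p)); last exact: time_const_le1.
by rewrite mulrC -ler_pdivlMr.
Qed.

Lemma lyapunov_continuous : {within `[0, T], continuous Phi}.
Proof.
apply: within_continuous_right => //.
  move=> t t0; have bt0 : 0 < b * t by rewrite mulr_gt0.
  have dbt : is_derive t 1 (fun s : R => b * s) b.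
    by apply: is_derive_eq; rewrite /GRing.scale/= mulr1.
  have h := is_deriveB (is_derive_mass t) (is_deriveZ (W `^ (p - 1))
    (is_deriveM (is_derive_powR_comp (- kap) dbt bt0) (is_derive_moment t0))).
  exact: (is_derive_continuous h).
rewrite {2}/Phi mulr0 powR0 ?oppr_eq0 ?gt_eqF// mul0r.
apply: cvgB; last by apply: cvgMl_tmp; exact: weighted_moment_cvg0.
by apply: cvg_at_right_filter; exact: (is_derive_continuous (is_derive_mass 0)).
Qed.

Let g (t : R) : R := (b * t) `^ kap * F t.

Let g_ge0 t : 0 <= g t.
Proof.
rewrite mulr_ge0 ?powR_ge0// sumr_ge0// => x _.
by rewrite mulr_ge0 ?powR_ge0// ltW// nu_gt0.
Qed.

Lemma lq_weight_continuous : {within `[0, T], continuous g}.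
Proof.
pose gn (t : R) := `|b * t| `^ kap * \sum_(x <- E) nu G x * `|u t x| `^ q.
suff cgn : {within `[0, T], continuous gn}.
  apply: (subspace_eq_continuous _ cgn) => t /set_mem /=; rewrite in_itv/= => /andP[t0 _].
  rewrite /from_subspace /g /gn (ger0_norm (mulr_ge0 (ltW b_gt0) t0)); congr (_ * _).
  by apply: eq_bigr => x _; rewrite ger0_norm// heat_ge0.
apply: continuous_subspaceT => t; apply: cvgM.
  apply: (@continuous_comp _ _ _ (fun s : R => b * s) (fun y => `|y| `^ kap)).
    exact: mulrl_continuous.
  exact: continuous_norm_powR.
apply: cvg_sum_seq => x _; apply: cvgMl_tmp.
have [Dx|Dx] := pselect (D x); last first.
  under eq_fun do rewrite heat_out//.
  by rewrite heat_out//; exact: cvg_cst.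
apply: (@continuous_comp _ _ _ (fun s => u s x) (fun y => `|y| `^ q)).
  exact: (is_derive_continuous (is_derive_heat G Dfin Do t Dx)).
exact: continuous_norm_powR.
Qed.

(** Let [X] be the right-hand side.  Integrating the Lyapunov inequality, the mass
    [M] stays above [3 / 4 - flux_const p * X] up to time [T]; since
    [M <= 1 / 4 + (4 W) `^ (q - 1) * F], the norm [F] is bounded below
    throughout, and integrating once more bounds [X] below. *)
Lemma heat_scale_lower_bound : ((scale_const p q)%:E <= (b * W `^ (q - 1))%:E *
  \int[lebesgue_measure]_(t in `[0%R, T]) (g t)%:E)%E.
Proof.
have [J [J0 Jc Jd ->]] := primitive_on_itv T_gt0 lq_weight_continuous.
rewrite -EFinM lee_fin.
pose X := b * W `^ (q - 1) * J T.
have C20 := flux_const_gt0 p12; have L1 := loss_const_ge1 p12.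
have Wq0 : 0 < W `^ (q - 1) by exact: powR_gt0.
have bW0 : 0 <= b * W `^ (q - 1) by rewrite mulr_ge0 ?ltW.
have sub t : 0 <= t -> {within `[t, T], continuous J}.
  move=> t0; apply: continuous_subspaceW Jc => s /=; rewrite !in_itv/= => /andP[ts ->].
  by rewrite (le_trans t0 ts).
have subl (f : R -> R) t : t <= T -> {within `[0, T], continuous f} ->
    {within `[0, t], continuous f}.
  move=> tT; apply: continuous_subspaceW => s /=; rewrite !in_itv/= => /andP[-> st].
  exact: le_trans st tT.
have Jmono t : 0 <= t -> t <= T -> J t <= J T.
  move=> t0 tT; apply: (@derive_ge0_le _ J g t T tT (sub t t0)).
    by move=> s /andP[ts sT]; apply: Jd; rewrite (le_lt_trans t0 ts).
  by move=> s _; exact: g_ge0.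
have step1 t : 0 <= t -> t <= T ->
    1 <= Phi t + (b * loss_const p) * t + (flux_const p * b * W `^ (q - 1)) * J t.
  move=> t0 tT.
  pose Psi s := Phi s + (b * loss_const p) * s + (flux_const p * b * W `^ (q - 1)) * J s.
  suff : Psi 0 <= Psi t by rewrite {1}/Psi lyapunov_at0 J0 !mulr0 !addr0.
  pose dPsi s := 'D_1 Phi s + (b * loss_const p) * 1 + (flux_const p * b * W `^ (q - 1)) * g s.
  apply: (@derive_ge0_le _ Psi dPsi 0 t t0).
  - have c1 := subl _ _ tT lyapunov_continuous; have c2 := subl _ _ tT Jc.
    move=> s; apply: cvgD; first (apply: cvgD; first exact: c1).
      by apply: cvgMl_tmp; apply: continuous_subspaceT => r; exact: cvg_id.
    by apply: cvgMl_tmp; exact: c2.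
  - move=> s /andP[s0 st].
    have sT : s < T by exact: lt_le_trans tT.
    have [dP dPE _] := lyapunov_derivative s0 (bT (ltW sT)).
    have dPE' : is_derive s 1 Phi ('D_1 Phi s) by rewrite (@derive_val _ _ _ _ _ _ _ dPE).
    have dJ : is_derive s 1 J (g s) by apply: Jd; rewrite s0 sT.
    exact: (is_deriveD (is_deriveD dPE' (is_deriveZ (b * loss_const p) (is_derive_id s 1)))
      (is_deriveZ (flux_const p * b * W `^ (q - 1)) dJ)).
  - move=> s /andP[s0 st].
    have sT : s < T by exact: lt_le_trans tT.
    have [dP dPE] := lyapunov_derivative s0 (bT (ltW sT)).
    rewrite /dPsi (@derive_val _ _ _ _ _ _ _ dPE) -/(g s); lra.
have step2 t : 0 < t -> t < T ->
    2^-1 - flux_const p * X <= 4 `^ (q - 1) * W `^ (q - 1) * F t.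
  move=> t0 tT; have := step1 t (ltW t0) (ltW tT).
  have Z0 : 0 <= W `^ (p - 1) * ((b * t) `^ (- kap) * Z t).
    rewrite mulr_ge0 ?powR_ge0// mulr_ge0 ?powR_ge0// sumr_ge0// => x _.
    by rewrite mulr_ge0 ?(ltW (nu_gt0 _ _))// mulr_ge0 ?powR_ge0 ?sqr_ge0.
  have PhiM : Phi t <= M t by rewrite /Phi; lra.
  have bt : b * t <= time_const p by rewrite mulrC -ler_pdivlMr// ltW.
  have Lt : b * loss_const p * t <= 4^-1.
    have := ler_wpM2l (le_trans ler01 L1) bt.
    rewrite (_ : loss_const p * time_const p = 4^-1) ?mulrA ?[loss_const p * b]mulrC//.
    by rewrite /time_const; field; rewrite gt_eqF// (lt_le_trans _ L1).
  have JX : b * W `^ (q - 1) * J t <= X by apply: ler_wpM2l (Jmono t (ltW t0) (ltW tT)).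
  have u0 x : 0 <= u t x by exact: heat_ge0 (ltW t0).
  have := local_mass_le u0 p12 W_gt0 W_ball pq.
  rewrite powRM ?(ltW W_gt0)// -/(M t) -/(F t).
  have := ler_wpM2l (ltW C20) JX; lra.
have key : 0 <= 4 `^ (q - 1) * W `^ (q - 1) * J T -
    (2^-1 - flux_const p * X) / (b * (kap + 1)) * (b * T) `^ (kap + 1).
  have k1 : 0 < kap + 1 by rewrite addr_gt0.
  pose A s := 4 `^ (q - 1) * W `^ (q - 1) * J s -
    (2^-1 - flux_const p * X) / (b * (kap + 1)) * (b * s) `^ (kap + 1).
  suff : A 0 <= A T by rewrite {1}/A J0 !mulr0 powR0 ?gt_eqF// mulr0 subrr.
  have dpow (s : R) : 0 < s -> is_derive s 1 (fun r => (b * r) `^ (kap + 1))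
      ((kap + 1) * (b * s) `^ kap * b).
    move=> s0; have bs0 : 0 < b * s by rewrite mulr_gt0.
    have dbs : is_derive s 1 (fun r : R => b * r) b.
      by apply: is_derive_eq; rewrite /GRing.scale/= mulr1.
    by have := is_derive_powR_comp (kap + 1) dbs bs0; rewrite addrK.
  apply: (@derive_ge0_le _ A (fun s => 4 `^ (q - 1) * W `^ (q - 1) * g s -
    (2^-1 - flux_const p * X) / (b * (kap + 1)) * ((kap + 1) * (b * s) `^ kap * b)) 0 T (ltW T_gt0)).
  - move=> s; apply: cvgB; first by apply: cvgMl_tmp; exact: Jc.
    apply: cvgMl_tmp; move: s; apply: within_continuous_right => //.
      by move=> s s0; exact: (is_derive_continuous (dpow s s0)).
    rewrite mulr0 powR0 ?gt_eqF//.
    apply: (@cvg_trans _ ((fun s : R => b `^ (kap + 1) * s `^ (kap + 1)) @ 0^'+)).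
      apply: near_eq_cvg; near=> s.
      have s0 : 0 < s by near: s; exact: nbhs_right_gt.
      by rewrite powRM// ltW.
    have h : b `^ (kap + 1) * s `^ (kap + 1) @[s --> 0^'+] --> b `^ (kap + 1) * 0.
      by apply: cvgMl_tmp; exact: powR_cvg0.
    by rewrite mulr0 in h.
  - move=> s /andP[s0 sT]; have dJ : is_derive s 1 J (g s) by apply: Jd; rewrite s0 sT.
    exact: (is_deriveB (is_deriveZ _ dJ) (is_deriveZ _ (dpow s s0))).
  - move=> s /andP[s0 sT].
    rewrite [X in _ - X](_ : _ = (2^-1 - flux_const p * X) * (b * s) `^ kap); last first.
      by field; rewrite !gt_eqF.
    have := ler_wpM2r (powR_ge0 (b * s) kap) (step2 s s0 sT); rewrite /g; lra.
rewrite -/X /scale_const ler_pdivrMr; last first.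
  by rewrite addr_gt0 ?powR_gt0// mulr_gt0 ?window_const_gt0.
have bTE : b * T = time_const p by rewrite /T mulrC divfK ?gt_eqF.
rewrite bTE in key.
have {}key := mulr_ge0 (ltW b_gt0) key.
have kE : b * (4 `^ (q - 1) * W `^ (q - 1) * J T -
        (2^-1 - flux_const p * X) / (b * (kap + 1)) * time_const p `^ (kap + 1)) =
   4 `^ (q - 1) * X - (2^-1 - flux_const p * X) * window_const p.
  rewrite /window_const -/kap /X; field.
  by rewrite !gt_eqF// addr_gt0.
rewrite kE in key; lra.
Unshelve. all: by end_near. Qed.

End Evolution.

(** * Path metric, balls and dyadic sums *)

Section PathMetric.
Context {R : realType} {V : choiceType} (G : wgraph R V).
Variables (rho : V -> V -> R) (o : V).
Hypothesis rho_len : edge_length G rho.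

Let lengths (x : V) : set R := [set path_length rho o p | p in
  [set p : seq V | path (adj G) o p /\ last o p = x]].

Lemma path_length_ge0 x p : path (adj G) x p -> 0 <= path_length rho x p.
Proof.
rewrite /path_length; elim: p x => [|y p IH] x /=; first by rewrite big_nil.
by move=> /andP[xy py]; rewrite big_cons/= addr_ge0 ?IH// ltW// rho_len.1.
Qed.

Lemma path_length_rcons x p y :
  path_length rho x (rcons p y) = path_length rho x p + rho (last x p) y.
Proof.
rewrite /path_length; elim: p x => [|z p IH] x /=.
  by rewrite !big_cons !big_nil addr0 add0r.
by rewrite !big_cons IH/= addrA.
Qed.

Let lengths_nonempty x : lengths x !=set0.
Proof.
have [p [pp px _]] := @adj_connected _ _ G o x I I.
by exists (path_length rho o p); exists p.
Qed.

Let lengths_lbound x : lbound (lengths x) 0.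
Proof. by move=> _ [p [pp _] <-]; exact: path_length_ge0. Qed.

Lemma path_dist_ge0 x : 0 <= path_dist G rho o x.
Proof. by apply: lb_le_inf; [exact: lengths_nonempty|exact: lengths_lbound]. Qed.

Lemma path_dist_le x p : path (adj G) o p -> last o p = x ->
  path_dist G rho o x <= path_length rho o p.
Proof.
move=> pp px; apply: ge_inf; first by exists 0; exact: lengths_lbound.
by exists p.
Qed.

Lemma path_dist_refl : path_dist G rho o o = 0.
Proof.
apply/eqP; rewrite eq_le path_dist_ge0 andbT.
apply: le_trans (@path_dist_le o [::] _ _) _ => //.
by rewrite /path_length big_nil.
Qed.

Lemma path_dist_adj x y : adj G x y ->
  path_dist G rho o y <= path_dist G rho o x + rho x y.
Proof.
move=> xy; rewrite -lerBlDr; apply: lb_le_inf; first exact: lengths_nonempty.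
move=> _ [p [pp px] <-]; rewrite lerBlDr -px -path_length_rcons.
by apply: path_dist_le; rewrite ?last_rcons// rcons_path pp px.
Qed.

(** Appending the edge to a path shows that the distance varies by at most the
    length of an edge. *)
Lemma path_dist_lipschitz x y : adj G x y ->
  `|path_dist G rho o x - path_dist G rho o y| <= rho x y.
Proof.
move=> xy; have yx : adj G y x by rewrite adj_sym.
have := path_dist_adj xy; have := path_dist_adj yx.
by rewrite -(rho_len.2 _ _ xy) ler_norml => h1 h2; apply/andP; split; lra.
Qed.

Lemma path_dist_adapted (E : {fset V}) (r : R) x : 0 < r -> adapted G rho ->
  \sum_(y <- E) edge_weight G x y *
    (path_dist G rho o x / r - path_dist G rho o y / r) ^+ 2 <= r ^- 2 * nu G x.
Proof.
move=> r0 /(adapted_sum_le E x) adx; have b0 : 0 <= r ^- 2 by rewrite invr_ge0 sqr_ge0.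
apply: le_trans (ler_wpM2l b0 adx).
rewrite mulr_sumr; apply: ler_sum => y _; rewrite [leRHS]mulrCA.
have [xy|/edge_weight_eq0 ->] := boolP (adj G x y); last by rewrite mul0r mul0r.
apply: ler_wpM2l; first exact: edge_weight_ge0.
rewrite -mulrBl exprMn exprVn mulrC; apply: ler_wpM2l; first by rewrite invr_ge0 sqr_ge0.
rewrite -[leLHS]real_normK ?num_real// lerXn2r ?nnegrE//; first exact: ltW (rho_len.1 _ _ xy).
exact: path_dist_lipschitz.
Qed.

Hypothesis rho_proper : proper_dist G rho.

Lemma ball_volume_mono r s : r <= s -> ball_volume G rho o r <= ball_volume G rho o s.
Proof.
move=> rs; rewrite /ball_volume !fsbig_finite//=; apply: ler_sum_fsubset.
  apply/fsubsetP => x; rewrite !in_fset_set// => /set_mem xr; apply/mem_set.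
  exact: le_trans xr rs.
by move=> x; exact/ltW/nu_gt0.
Qed.

Lemma ball_volume_gt0 r : 0 <= r -> 0 < ball_volume G rho o r.
Proof.
move=> r0; rewrite /ball_volume fsbig_finite//= (big_fsetD1 o)/=; last first.
  by rewrite in_fset_set//; apply/mem_set; rewrite /dball/= path_dist_refl.
by rewrite ltr_wpDr ?nu_gt0// sumr_ge0// => x _; exact/ltW/nu_gt0.
Qed.

Lemma ball_volume_closed_nbhd (D : set V) r : finite_set D -> 0 < r ->
  dball G rho o r `<=` D ->
  \sum_(x <- closed_nbhd G D) (if path_dist G rho o x / r <= 1 then nu G x else 0)
  = ball_volume G rho o r.
Proof.
move=> Dfin r0 rD; rewrite /ball_volume fsbig_finite//=.
have inb x : (path_dist G rho o x / r <= 1) = (path_dist G rho o x <= r).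
  by rewrite ler_pdivrMr// mul1r.
rewrite -(@big_fset_incl _ _ _ _ (fset_set (dball G rho o r))); first last.
- move=> x _; rewrite in_fset_set// inb; case: ifP => // xr.
  by rewrite mem_set.
- apply/fsubsetP => x; rewrite in_fset_set// => /set_mem xr.
  by apply: mem_closed_nbhd => //; exact: rD.
apply: eq_big_seq => x; rewrite in_fset_set// => /set_mem; rewrite /dball/= => xr.
by rewrite inb xr.
Qed.

End PathMetric.

Section IntegralComparison.
Context d (T : measurableType d) (R : realType) (m : {measure set T -> \bar R}).

(** For nonnegative functions the integral is a supremum over simple functions
    below the integrand, hence monotone without measurability.  This spares a
    proof that the heat kernel and the volume function are measurable. *)
Lemma ge0_le_integral_subset (A B : set T) (f g : T -> \bar R) : A `<=` B ->
  (forall x, B x -> (0 <= g x)%E) -> (forall x, A x -> (0 <= f x)%E) ->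
  (forall x, A x -> (f x <= g x)%E) ->
  (\int[m]_(x in A) f x <= \int[m]_(x in B) g x)%E.
Proof.
move=> AB g0 f0 fg; rewrite !ge0_integralE//; apply: ereal_sup_le.
move=> _ [h hf <-]; exists h => // x; apply: le_trans (hf x) _.
rewrite !patchE; case: ifPn => [/set_mem Ax|_].
  by rewrite mem_set ?fg//; exact: AB.
by case: ifPn => // /set_mem Bx; exact: g0.
Qed.

End IntegralComparison.

Section DyadicSums.
Context {R : realType}.

Lemma dyadic_scale (r : R) : 2 <= r ->
  exists k : nat, 2 ^+ k.+1 <= r < 2 ^+ k.+2.
Proof.
move=> r2; have r0 : 0 <= r by exact: le_trans r2.
have /andP[nr rn] := truncn_itv r0; set n := Num.truncn r in nr rn.
have n2 : (2 <= n)%N by rewrite /n truncn_ge_nat.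
have n0 : (0 < n)%N by exact: leq_trans n2.
have /andP[kn nk] := trunc_log_bounds (isT : (1 < 2)%N) n0.
have k0 : (0 < trunc_log 2 n)%N by apply: trunc_log_max.
exists (trunc_log 2 n).-1; rewrite prednK//; apply/andP; split.
  by apply: le_trans nr; rewrite -natrX ler_nat.
by apply: lt_le_trans rn _; rewrite -natrX ler_nat.
Qed.

Lemma powR4N_lt1 (k : R) : 0 < k -> 4 `^ (- k) < 1 :> R.
Proof.
move=> k0; rewrite powRN invf_lt1 ?powR_gt0//.
have : (1 : R) `^ k < 4 `^ k by apply: gt0_ltr_powR; rewrite ?nnegrE// ltr1n.
by rewrite powR1.
Qed.

(** As long as [t <= 4 ^+ i.+1], the [i]-th term is the decrement of
    [min 1 ((t / 4 ^+ i.+1) `^ k)] from [i] to [i.+1], so the sum telescopes. *)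
Lemma dyadic_weight_sum (k : R) (n : nat) (t : R) : 0 < k -> 0 <= t ->
  \sum_(0 <= i < n) (if t <= 4 ^+ i.+1 then (1 - 4 `^ (- k)) * (t / 4 ^+ i.+1) `^ k else 0)
  <= 1.
Proof.
move=> k0 t0; pose h i := Num.min 1 ((t / 4 ^+ i.+1) `^ k).
have d1 : 4 `^ (- k) <= 1 :> R by exact/ltW/powR4N_lt1.
have hS i : t / 4 ^+ i.+2 = 4^-1 * (t / 4 ^+ i.+1) by rewrite [in LHS]exprS invfM mulrCA.
have step i : (if t <= 4 ^+ i.+1 then (1 - 4 `^ (- k)) * (t / 4 ^+ i.+1) `^ k else 0)
    <= h i - h i.+1.
  have s0 : 0 <= t / 4 ^+ i.+1 by rewrite divr_ge0 ?exprn_ge0.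
  have sk : (t / 4 ^+ i.+2) `^ k = 4 `^ (- k) * (t / 4 ^+ i.+1) `^ k.
    rewrite hS [LHS]powRM ?invr_ge0//; congr (_ * _).
    by rewrite -powR_inv1// -powRrM mulN1r.
  have sle : (t / 4 ^+ i.+2) `^ k <= (t / 4 ^+ i.+1) `^ k.
    by rewrite sk ler_piMl ?powR_ge0.
  case: ifPn => ti; last first.
    by rewrite subr_ge0 /h le_min2.
  have s1 : (t / 4 ^+ i.+1) `^ k <= 1.
    have : (t / 4 ^+ i.+1) `^ k <= 1 `^ k.
      rewrite ge0_ler_powR ?nnegrE// ?(ltW k0)//.
      by rewrite ler_pdivrMr ?exprn_gt0// mul1r.
    by rewrite powR1.
  by rewrite /h (min_r s1) (min_r (le_trans sle s1)) sk; lra.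
apply: (@le_trans _ _ (h 0%N - h n)).
  elim: n => [|n IH]; first by rewrite big_geq// subrr.
  rewrite big_nat_recr//; apply: le_trans (lerD IH (step n)) _.
  by rewrite addrA subrK.
have : h 0%N <= 1 by rewrite /h ge_min lexx.
have : 0 <= h n by rewrite /h le_min ler01 powR_ge0.
lra.
Qed.

(** Dominate [f] by its step function on the intervals
    between consecutive powers of 2. *)
Lemma dyadic_integral_le (f : R -> R) (a : nat -> R) :
  (forall r, 2 <= r -> 0 <= f r) -> (forall k, 0 <= a k) ->
  (forall k r, 2 ^+ k.+1 <= r -> r < 2 ^+ k.+2 -> f r <= a k) ->
  (\int[lebesgue_measure]_(r in `[2%R, +oo[) (f r)%:E <=
   \sum_(0 <= k <oo) (a k * 2 ^+ k.+1)%:E)%E.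
Proof.
move=> f0 a0 fa.
pose I k : set R := `[2 ^+ k.+1, 2 ^+ k.+2[%classic.
have muI k : lebesgue_measure (I k) = (2 ^+ k.+1)%:E :> \bar R.
  rewrite /I lebesgue_measure_itv/= lte_fin ltr_eXn2l ?ltr1n// ltnS leqnn -EFinB.
  by rewrite [2 ^+ k.+2]exprS; congr (_%:E); ring.
have mI k : measurable_fun [set: R] (fun r => (\1_(I k) r)%:E : \bar R).
  by apply/measurable_EFinP; apply: measurable_indic; exact: measurable_itv.
have term0 k r : (0 <= (a k)%:E * (\1_(I k) r)%:E)%E.
  by rewrite mule_ge0// lee_fin.
have -> : (\sum_(0 <= k <oo) (a k * 2 ^+ k.+1)%:E)%E =
    (\int[lebesgue_measure]_(r in [set: R]) \sum_(0 <= k <oo) ((a k)%:E * (\1_(I k) r)%:E))%E.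
  rewrite integral_nneseries//; last first.
    by move=> k; apply: measurable_funeM; exact: mI.
  apply: eq_eseriesr => k _.
  rewrite ge0_integralZl_EFin//; last exact: mI.
  rewrite integral_indic//; last exact: measurable_itv.
  by rewrite setIT EFinM; congr (_ * _)%E; rewrite -muI.
apply: ge0_le_integral_subset => //.
- by move=> r _; apply: nneseries_ge0.
- by move=> r /=; rewrite in_itv/= andbT lee_fin => /f0.
- move=> r /=; rewrite in_itv/= andbT => /dyadic_scale[k /andP[kr rk]].
  have kI : \1_(I k) r = 1 :> R by rewrite indicE mem_set//= /I/= in_itv/= kr rk.
  apply: (@le_trans _ _ ((a k)%:E * (\1_(I k) r)%:E)%E).
    by rewrite kI mule1 lee_fin fa.
  apply: le_trans (nneseries_lim_ge k.+1 (fun n _ _ => term0 n r)).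
  by rewrite big_nat_recr//= leeDr// sume_ge0.
Qed.

End DyadicSums.

(** * Summation over scales *)

Section Exhaustion.
Context {R : realType} {V : choiceType} (G : wgraph R V).
Variables (D : nat -> set V) (hD : exhaustion G D).

Lemma exhaustion_finite j : finite_set (D j).
Proof. by case: hD => + _ _ => /(_ j)[]. Qed.

Lemma exhaustion_connected j : connected_in (adj G) (D j).
Proof. by case: hD => + _ _ => /(_ j)[]. Qed.

Lemma exhaustion_sub i j : (i <= j)%N -> D i `<=` D j.
Proof.
move=> /subnKC <-; elim: (j - i)%N => [|m IH]; first by rewrite addn0.
by rewrite addnS; case: hD => _ /(_ (i + m)%N) + _; exact: subset_trans.
Qed.

Lemma exhaustion_absorbs (A : set V) : finite_set A -> exists j, A `<=` D j.
Proof.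
move=> /finite_seqP[s ->]; elim: s => [|x s [j sj]]; first by exists 0%N.
have [i _ Dx] : (\bigcup_j D j) x by case: hD => _ _ ->.
exists (maxn i j) => y /=; rewrite inE => /predU1P[->|ys].
  exact: exhaustion_sub (leq_maxl _ _) _ Dx.
by apply: exhaustion_sub (leq_maxr _ _) _ _; exact: sj.
Qed.

End Exhaustion.

Section MainEstimate.
Context {R : realType} {V : choiceType} (G : wgraph R V).
Variables (rho : V -> V -> R) (o : V) (p q : R).
Hypothesis rho_len : edge_length G rho.
Hypothesis rho_adapted : adapted G rho.
Hypothesis rho_proper : proper_dist G rho.
Hypothesis p12 : 1 < p <= 2.
Hypothesis pq : p <= q.

Let kap : R := (p - 1) / 2.
Let kap_gt0 : 0 < kap.
Proof. by case/andP: p12 => p1 _; rewrite /kap divr_gt0// subr_gt0. Qed.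

Section OneDomain.
Variables (D : set V) (Dfin : finite_set D) (Dcon : connected_in (adj G) D).
Local Notation u t := (dirichlet_heat_kernel G D t o).
Local Notation F t := (lp_sum G (closed_nbhd G D) (u t) q).

(** The scale estimate with distances measured in units of [r], so that [b] is
    [r ^- 2]. *)
Lemma heat_ball_lower_bound r : 0 < r -> dball G rho o r `<=` D ->
  let g t := (r ^- 2 * t) `^ kap * F t in
  let T := time_const p / r ^- 2 in
  {within `[0, T], continuous g} /\
  ((scale_const p q)%:E <= (r ^- 2 * ball_volume G rho o r `^ (q - 1))%:E *
     \int[lebesgue_measure]_(t in `[0%R, T]) (g t)%:E)%E.
Proof.
move=> r0 rD; have b0 : 0 < r ^- 2 by rewrite invr_gt0 exprn_gt0.
have Do : D o by apply: rD; rewrite /dball/= path_dist_refl// ltW.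
have W0 := ball_volume_gt0 o rho_len rho_proper (ltW r0).
have e0 x : 0 <= path_dist G rho o x / r by rewrite divr_ge0 ?path_dist_ge0// ltW.
have eo : path_dist G rho o o / r = 0 by rewrite path_dist_refl// mul0r.
have eD x : path_dist G rho o x / r <= 1 -> D x.
  by rewrite ler_pdivrMr// mul1r => xr; exact: rD.
have ead x := path_dist_adapted o rho_len (closed_nbhd G D) x r0 rho_adapted.
have WE : \sum_(x <- closed_nbhd G D) (if path_dist G rho o x / r <= 1 then nu G x else 0)
    <= ball_volume G rho o r.
  by rewrite (ball_volume_closed_nbhd (o := o) rho_proper Dfin r0 rD).
split; first exact: (lq_weight_continuous Dfin Do b0 p12 pq).
exact: (heat_scale_lower_bound Dfin Dcon Do e0 eo eD b0 ead W0 WE p12 pq).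
Qed.

End OneDomain.

Variables (D : nat -> set V) (hD : exhaustion G D).

Let delta : R := 1 - 4 `^ (- kap).

Let delta_gt0 : 0 < delta.
Proof. by rewrite subr_gt0; exact: powR4N_lt1. Qed.

(** Domain monotonicity. *)
Lemma lp_sum_le_esum (j : nat) (t : R) : 0 <= t ->
  ((lp_sum G (closed_nbhd G (D j)) (dirichlet_heat_kernel G (D j) t o) q)%:E <=
   \esum_(x in [set: V]) (heat_kernel G D t o x `^ q * nu G x)%:E)%E.
Proof.
move=> t0; have q0 : 0 <= q by move: p12 pq => /andP[] *; lra.
apply: esum_ge; exists [set` closed_nbhd G (D j)] => //.
rewrite fsbig_finite//= set_fsetK sumEFin lee_fin; apply: ler_sum => x _.
rewrite mulrC ler_wpM2r ?(ltW (nu_gt0 _ _))//.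
have u0 : 0 <= dirichlet_heat_kernel G (D j) t o x.
  have [Do|Do] := pselect (D j o); last by rewrite dirichlet_heat_kernel_outl.
  by apply: heat_ge0 => //; exact: exhaustion_finite hD j.
have uh := dirichlet_le_heat_kernel o x j hD t0.
by apply: ge0_ler_powR; rewrite ?nnegrE// (le_trans u0 uh).
Qed.

(** One domain of the exhaustion contains the largest ball in use; the scale
    estimate is applied to it at the radii [2 ^+ k.+1] and the time weights add up
    to at most a constant. *)
Lemma dyadic_heat_sum (n : nat) :
  ((delta * scale_const p q)%:E * \sum_(0 <= k < n)
     (4 ^+ k.+1 / ball_volume G rho o (2 ^+ k.+1) `^ (q - 1))%:E <= Hq G D q o)%E.
Proof.
have [j jD] := exhaustion_absorbs hD (rho_proper o (2 ^+ n)).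
have Dfin := exhaustion_finite hD j; have Dcon := exhaustion_connected hD (j := j).
pose F t := lp_sum G (closed_nbhd G (D j)) (dirichlet_heat_kernel G (D j) t o) q.
pose T k : R := time_const p * 4 ^+ k.+1.
pose g k t : R := delta * ((t / 4 ^+ k.+1) `^ kap * F t).
have F0 t : 0 <= F t.
  by rewrite sumr_ge0// => x _; rewrite mulr_ge0 ?powR_ge0// ltW// nu_gt0.
have g0 k t : 0 <= g k t by rewrite mulr_ge0 ?(ltW delta_gt0)// mulr_ge0 ?powR_ge0.
have gk k : (k < n)%N -> {within `[0, T k], continuous (g k)} /\
   ((delta * scale_const p q * (4 ^+ k.+1 / ball_volume G rho o (2 ^+ k.+1) `^ (q - 1)))%:E
     <= \int[lebesgue_measure]_(t in `[0%R, T k]) (g k t)%:E)%E.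
  move=> kn; have r0 : 0 < 2 ^+ k.+1 :> R by rewrite exprn_gt0.
  have rD : dball G rho o (2 ^+ k.+1) `<=` D j.
    move=> x xr; apply: jD; apply: le_trans xr _.
    by rewrite ler_weXn2l// ler1n.
  have b4 : (2 ^+ k.+1) ^- 2 = 4 ^- k.+1 :> R.
    by rewrite -exprM mulnC exprM -natrX.
  pose h t := (4 ^- k.+1 * t) `^ kap * F t.
  have [ch ih] : {within `[0, T k], continuous h} /\ ((scale_const p q)%:E <=
      (4 ^- k.+1 * ball_volume G rho o (2 ^+ k.+1) `^ (q - 1))%:E *
      \int[lebesgue_measure]_(t in `[0%R, T k]) (h t)%:E)%E.
    have := heat_ball_lower_bound Dfin Dcon r0 rD; rewrite /= b4.
    by rewrite (_ : time_const p / 4 ^- k.+1 = T k)// invrK.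
  have gE : g k = (fun t => delta * h t).
    by apply/funext => t; rewrite /g /h [t / _]mulrC.
  split; first by rewrite gE => t; apply: cvgMl_tmp; exact: ch.
  have mh : measurable_fun `[0, T k] (fun t => (h t)%:E : \bar R).
    by apply/measurable_EFinP; apply: subspace_continuous_measurable_fun.
  rewrite gE; under eq_integral do rewrite EFinM.
  rewrite ge0_integralZl_EFin ?(ltW delta_gt0)//; last first.
    by move=> t _; rewrite lee_fin; exact: mulr_ge0 (powR_ge0 _ _) (F0 t).
  rewrite -mulrA EFinM; apply: lee_wpmul2l; first by rewrite lee_fin ltW.
  have V0 : 0 < ball_volume G rho o (2 ^+ k.+1) `^ (q - 1).
    by rewrite powR_gt0// ball_volume_gt0// ltW.
  have c4 : 0 < 4 ^+ k.+1 :> R by rewrite exprn_gt0.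
  move: ih; rewrite -lee_pdivrMl; last by rewrite mulr_gt0// invr_gt0.
  move=> ih'; apply: le_trans _ ih'; rewrite -EFinM lee_fin le_eqVlt; apply/orP; left; apply/eqP.
  by field; rewrite !gt_eqF.
have gm k : (k < n)%N -> measurable_fun (`[0, +oo[%classic : set R)
    ((fun t : R => (g k t)%:E) \_ `[0, T k]).
  move=> /gk[cg _]; apply: measurable_funTS; apply/(measurable_restrictT _ _).1 => //.
  by apply/measurable_EFinP; apply: subspace_continuous_measurable_fun.
pose h k : R -> \bar R :=
  if (k < n)%N then (fun t : R => (g k t)%:E) \_ `[0, T k] else cst 0%E.
have h0 k t : (0 <= h k t)%E.
  by rewrite /h; case: ifP => // _; rewrite patchE; case: ifP => // _; rewrite lee_fin.
have hm k : measurable_fun (`[0%R, +oo[%classic : set R) (h k).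
  rewrite /h; have [kn|_] := boolP (k < n)%N; last exact: measurable_cst.
  exact: gm.
apply: (@le_trans _ _ (\sum_(0 <= k < n) \int[lebesgue_measure]_(t in `[0%R, +oo[) h k t)%E).
  rewrite ge0_sume_distrr; last first.
    by move=> k _; rewrite lee_fin divr_ge0 ?exprn_ge0 ?powR_ge0.
  rewrite big_nat_cond [leRHS]big_nat_cond; apply: lee_sum => k /andP[/andP[_ kn] _].
  have [_] := gk k kn; rewrite -EFinM => /le_trans; apply.
  rewrite /h kn -integral_mkcondr setIidr//.
  by move=> t /=; rewrite !in_itv/= => /andP[->].
rewrite -ge0_integral_sum//.
apply: ge0_le_integral_subset => //.
- by move=> t _; apply: esum_ge0 => x _; rewrite lee_fin mulr_ge0 ?powR_ge0// ltW// nu_gt0.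
- by move=> t _; apply: sume_ge0.
move=> t /=; rewrite in_itv/= andbT => t0.
apply: le_trans (lp_sum_le_esum j t0).
apply: (@le_trans _ _ (\sum_(0 <= k < n)
   (if t <= 4 ^+ k.+1 then delta * (t / 4 ^+ k.+1) `^ kap else 0) * F t)%:E).
  rewrite -sumEFin big_nat_cond [leRHS]big_nat_cond.
  apply: lee_sum => k /andP[/andP[_ kn] _].
  rewrite /h kn patchE; case: ifPn => [/set_mem/=|_]; last first.
    by rewrite lee_fin mulr_ge0//; case: ifP => // _; rewrite mulr_ge0 ?powR_ge0// ltW.
  rewrite in_itv/= => /andP[_ tT]; have t4 : t <= 4 ^+ k.+1.
    apply: le_trans tT _; rewrite /T ler_piMl ?exprn_ge0//; exact: time_const_le1.
  by rewrite t4 /g mulrA.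
rewrite lee_fin -mulr_suml ler_piMl//; exact: dyadic_weight_sum.
Qed.

End MainEstimate.

Theorem theorem1p4 (R : realType) (q : R) (hq : 1 < q) :
  exists c : R, 0 < c /\
    forall (V : choiceType) (G : wgraph R V) (rho : V -> V -> R),
      edge_length G rho -> adapted G rho -> proper_dist G rho ->
      forall (D : nat -> set V), exhaustion G D ->
      forall o : V,
        (c%:E * \int[lebesgue_measure]_(r in `[2%R, +oo[)
                  (r / ball_volume G rho o r `^ (q - 1))%:E
         <= Hq G D q o)%E.
Proof.
(* beyond 2 the concavity of s^(p-1) is lost, while truncation compares p with q *)
pose p := Num.min q 2.
have p12 : 1 < p <= 2 by rewrite /p lt_min hq ltr1n/= ge_min lexx orbT.
have pq : p <= q by rewrite /p ge_min lexx.
pose delta : R := 1 - 4 `^ (- ((p - 1) / 2)).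
have d0 : 0 < delta.
  have k0 : 0 < (p - 1) / 2 by case/andP: p12 => p1 _; rewrite divr_gt0// subr_gt0.
  by rewrite subr_gt0; exact: powR4N_lt1.
have c0 : 0 < delta * scale_const p q / 2.
  by rewrite divr_gt0// mulr_gt0// scale_const_gt0.
exists (delta * scale_const p q / 2); split => //.
move=> V G rho rho_len rho_ad rho_pr D hD o.
pose a k : R := 2 ^+ k.+2 / ball_volume G rho o (2 ^+ k.+1) `^ (q - 1).
have a0 k : 0 <= a k by rewrite divr_ge0 ?exprn_ge0 ?powR_ge0.
rewrite -lee_pdivlMl//.
apply: le_trans (dyadic_integral_le (a := a) _ _ _) _ => //.
- by move=> r r2; rewrite divr_ge0 ?powR_ge0//; exact: le_trans r2.
- move=> k r kr rk; have r0 : 0 <= r by apply: le_trans kr; rewrite exprn_ge0.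
  have V0 : 0 < ball_volume G rho o (2 ^+ k.+1) by rewrite ball_volume_gt0// exprn_ge0.
  have Vr := ball_volume_mono o rho_pr kr.
  rewrite /a; apply: ler_pM => //; first by rewrite invr_ge0 powR_ge0.
    exact: ltW.
  rewrite lef_pV2 ?posrE ?powR_gt0//; last exact: lt_le_trans Vr.
  by apply: ge0_ler_powR; rewrite ?nnegrE ?subr_ge0 ?(ltW hq) ?(ltW V0)// (le_trans (ltW V0)).
apply: lime_le.
  by apply: is_cvg_nneseries => k _ _; rewrite lee_fin mulr_ge0// exprn_ge0.
apply: nearW => n; rewrite lee_pdivlMl//.
apply: le_trans _ (dyadic_heat_sum o rho_len rho_ad rho_pr p12 pq hD n).
rewrite !sumEFin -!EFinM lee_fin !mulr_sumr; apply: ler_sum => k _.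
rewrite le_eqVlt; apply/orP; left; apply/eqP; rewrite /a.
have -> : 4 ^+ k.+1 = 2 ^+ k.+1 * 2 ^+ k.+1 :> R by rewrite -exprMn -natrM.
by rewrite [2 ^+ k.+2]exprS -/delta; field; rewrite gt_eqF// powR_gt0// ball_volume_gt0// exprn_ge0.
Qed.
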